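(* Let $\Omega=\mathbb{R}^d_+$, let $f$ and $g_1,\dots,g_m$ be CPWA functions on $\Omega$, and assume $\phi(f)<\infty$ and $\phi(-f)<\infty$. Run the Exterior Cutting Plane (ECP) Algorithm described in the context, with inputs $\overline{x}$ and $\underline{\phi}$ (and the others) as specified there. Then: (i) If the no-arbitrage condition (NA) holds, then $\underline{\varphi}^{(r)}$ is non-decreasing in $r$, and at any stage of the algorithm $s^{(r)}\le0$ and $\underline{\varphi}^{(r)}\le\phi(f)\le\underline{\varphi}^{(r)}-s^{(r)}$. (ii) If (NA) holds, then the algorithm terminates after finitely many iterations with an $\varepsilon$-optimal solution $(c^\star,y^\star)$ of the minimization problem defining $\phi(f)$ (that is, $c^\star+\langle y^\star,g\rangle\ge f$ on $\Omega$ and $c^\star+\pi(y^\star)\le\phi(f)+\varepsilon$), and $\phi(f)^{\mathrm{LB}}\le\phi(f)\le\phi(f)^{\mathrm{UB}}$ with $\phi(f)^{\mathrm{UB}}-\phi(f)^{\mathrm{LB}}\le\varepsilon$. (iii) If the algorithm terminates by reporting unboundedness (i.e. it reaches its final step with $\phi(f)^{\mathrm{UB}}<\underline{\phi}$), then (NA) is violated and the minimization problem defining $\phi(f)$ is unbounded (i.e. $\phi(f)=-\infty$).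
   Context: **Setting.** Vector inequalities are componentwise; $x>0$ means all components are positive. A function $h$ is CPWA (continuous piece-wise affine) if $h(x)=\sum_{k=1}^K\xi_k\max\{\langle a_{k,i},x\rangle+b_{k,i}:1\le i\le I_k\}$ with $K,I_k\in\mathbb{N}$, $a_{k,i}\in\mathbb{R}^d$, $b_{k,i}\in\mathbb{R}$, $\xi_k\in\{-1,1\}$. Its radial function on $\mathbb{R}^d_+$ is $\widetilde h(z):=\sum_{k=1}^K\xi_k\max\{\langle a_{k,i},z\rangle:1\le i\le I_k\}$. Let $g=(g_1,\dots,g_m)^{\mathsf T}$, and let $\underline{\pi}_j\le\overline{\pi}_j$ be reals, $\overline{\pi}=(\overline{\pi}_j)_j$, $\underline{\pi}=(\underline{\pi}_j)_j\in\mathbb{R}^m$. For $y\in\mathbb{R}^m$, $\pi(y):=\sum_j(\max\{y_j,0\}\overline{\pi}_j-\max\{-y_j,0\}\underline{\pi}_j)$. For a function $f$ on $\Omega$, $$\phi(f):=\inf\{c+\pi(y):c\in\mathbb{R},\,y\in\mathbb{R}^m,\,c+\langle y,g(x)\rangle\ge f(x)\ \forall x\in\Omega\}.$$ (NA): for every $y\in\mathbb{R}^m$, if $\langle y,g\rangle-\pi(y)\ge0$ on $\Omega$ then $\langle y,g\rangle-\pi(y)=0$ on $\Omega$. The slack function is $s_y(x):=\langle y,g(x)\rangle-f(x)$, $x\in\mathbb{R}^d_+$; it is CPWA in $x$, and $\widetilde s_y$ denotes its radial function. Fix a representation, valid for all $y\in\mathbb{R}^m$, $z\in\mathbb{R}^d_+$,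 $$\widetilde s_y(z)=\sum_{k=1}^{\widetilde K}(\langle y,\widetilde w_k\rangle+\widetilde z_k)\max\{\langle\widetilde a_{k,i},z\rangle:1\le i\le\widetilde I_k\}.$$ **Radial constraints $\widetilde\sigma$.** This is a system of linear inequalities in $y$ and auxiliary variables, initially empty. For every multi-index $(i_k)=(i_1,\dots,i_{\widetilde K})$ with $1\le i_k\le\widetilde I_k$, let $A_{(i_k)}:=\{\widetilde a_{k,i_k}-\widetilde a_{k,i}:i\neq i_k,\,1\le i\le \widetilde I_k,\,1\le k\le\widetilde K\}\setminus\{0\}$. If there do NOT exist $\eta_v\ge0$ ($v\in A_{(i_k)}$) with $\sum_v\eta_v=1$ and $\sum_v\eta_v v\le0$, then add to $\widetilde\sigma$ new auxiliary variables $\eta^{(i_k)}_v\ge0$ ($v\in A_{(i_k)}$) and the inequality $\sum_{k=1}^{\widetilde K}(\langle y,\widetilde w_k\rangle+\widetilde z_k)\widetilde a_{k,i_k}\ge\sum_{v\in A_{(i_k)}}\eta^{(i_k)}_v v$. **Inputs.** $\overline\pi,\underline\pi,g,f$; a finite (possibly empty) set $X^{(0)}\subset\mathbb{R}^d_+$; numbers $\varepsilon>0$, $\tau>0$, $0<\delta\le1$; - $\overline x\in\mathbb{R}^d$, $\overline x>0$, such that for every $y\in\mathbb{R}^m$ with $\inf_{x\in\mathbb{R}^d_+}s_y(x)>-\infty$ one has $\inf_{0\le x\le\overline x}s_y(x)=\inf_{x\in\mathbb{R}^d_+}s_y(x)$ (such $\overline x$ exists); - $\underline\phi:=-c_0-\pi(y_0)$,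 where $c_0\in\mathbb{R}$, $y_0\in\mathbb{R}^m$ satisfy $c_0+\langle y_0,g\rangle\ge-f$ on $\Omega$. **ECP Algorithm.** 1. Build $\widetilde\sigma$. Let $\sigma$ be the system consisting of all variables and inequalities of $\widetilde\sigma$, additional variables $c\in\mathbb{R}$, $y^+\ge0$, $y^-\ge0$ (in $\mathbb{R}^m$), and the equality $y=y^+-y^-$. Add to $\sigma$ the inequality $c+\langle y^+,\overline\pi\rangle-\langle y^-,\underline\pi\rangle\ge\underline\phi-\tau$. Set $r\leftarrow0$. 2. Repeat: (a) for each $x\in X^{(r)}$ add $c+\langle y^+-y^-,g(x)\rangle\ge f(x)$ to $\sigma$; (b) solve the linear program: $\underline\varphi^{(r)}\leftarrow$ minimum of $c+\langle y^+,\overline\pi\rangle-\langle y^-,\underline\pi\rangle$ subject to $\sigma$, with minimizer $(c^{(r)},y^{+(r)},y^{-(r)})$; set $y^{(r)}\leftarrow y^{+(r)}-y^{-(r)}$; (c) $s^{(r)}\leftarrow c^{(r)}+\min_{0\le x\le\overline x}s_{y^{(r)}}(x)$ (computed exactly, via a mixed-integer linear program solved by branch-and-bound); (d) $X^{(r+1)}\leftarrow$ the finite set of those points $x$, $0\le x\le\overline x$, found by the solver in (c) (these include a minimizer) that satisfy $c^{(r)}+s_{y^{(r)}}(x)\le\delta s^{(r)}$; (e) $r\leftarrow r+1$; until $s^{(r-1)}\ge-\varepsilon$. 3. Set $\phi(f)^{\mathrm{LB}}\leftarrow\underline\varphi^{(r-1)}$, $\phi(f)^{\mathrm{UB}}\leftarrow\underline\varphi^{(r-1)}-s^{(r-1)}$,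 $c^\star\leftarrow c^{(r-1)}-s^{(r-1)}$, $y^\star\leftarrow y^{(r-1)}$, $X\leftarrow\bigcup_{l=0}^{r-1}X^{(l)}$. 4. If $\phi(f)^{\mathrm{UB}}<\underline\phi$, report that the problem is unbounded; otherwise return $\phi(f)^{\mathrm{UB}},\phi(f)^{\mathrm{LB}},c^\star,y^\star,X$. *)

(* Defs.v *)
From HB Require Import structures.
From mathcomp Require Import all_boot all_order all_algebra finmap.
From mathcomp Require Import all_classical all_reals ereal.

Set Implicit Arguments.
Unset Strict Implicit.
Unset Printing Implicit Defensive.

Import Order.TTheory GRing.Theory Num.Theory.
Local Open Scope ring_scope.

(** * Vectors *)

Definition lev (R : realType) (n : nat) (u v : 'rV[R]_n) : Prop :=
  forall i, u 0 i <= v 0 i.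

Definition dot (R : realType) (n : nat) (u v : 'rV[R]_n) : R :=
  \sum_i u 0 i * v 0 i.

(* The domain Omega. *)
Definition orthant (R : realType) (d : nat) : set 'rV[R]_d :=
  [set x | lev 0 x]%classic.

Definition box (R : realType) (d : nat) (b : 'rV[R]_d) : set 'rV[R]_d :=
  [set x | lev 0 x /\ lev x b]%classic.

(* The families over which maxima are taken are indexed by 'I_n.+1, hence
   nonempty; the unit F ord0 is one of the values. *)
Definition fmax (R : realType) (n : nat) (F : 'I_n.+1 -> R) : R :=
  \big[Num.max/F ord0]_(i < n.+1) F i.

(** * Continuous piece-wise affine functions *)

(* K = cp_size, I_k = (cp_pieces k).+1 and xi_k = (-1) ^+ cp_neg k. *)
Record cpwa (R : realType) (d : nat) := Cpwa {
  cp_size : nat;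
  cp_pieces : 'I_cp_size -> nat;
  cp_slope : forall k, 'I_(cp_pieces k).+1 -> 'rV[R]_d;
  cp_const : forall k, 'I_(cp_pieces k).+1 -> R;
  cp_neg : 'I_cp_size -> bool }.

Definition cpwa_val (R : realType) (d : nat) (h : cpwa R d) (x : 'rV[R]_d) : R :=
  \sum_(k < cp_size h) (-1) ^+ cp_neg k *
    fmax (fun i : 'I_(cp_pieces k).+1 => dot (cp_slope i) x + cp_const i).

Definition cpwa_radial (R : realType) (d : nat) (h : cpwa R d)
    (z : 'rV[R]_d) : R :=
  \sum_(k < cp_size h) (-1) ^+ cp_neg k *
    fmax (fun i : 'I_(cp_pieces k).+1 => dot (cp_slope i) z).

Definition is_cpwa (R : realType) (d : nat) (h : 'rV[R]_d -> R) : Prop :=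
  exists r : cpwa R d, forall x, orthant x -> h x = cpwa_val r x.

(* ht is the radial function of h on the orthant.  It does not depend on the
   representation r, since ht z is the limit of h (t z) / t as t -> +oo. *)
Definition is_radial (R : realType) (d : nat) (h ht : 'rV[R]_d -> R) : Prop :=
  exists r : cpwa R d,
    (forall x, orthant x -> h x = cpwa_val r x) /\
    (forall z, orthant z -> ht z = cpwa_radial r z).

(** * The super-replication problem *)

Definition price (R : realType) (m : nat) (ask bid y : 'rV[R]_m) : R :=
  \sum_j (Num.max (y 0 j) 0 * ask 0 j - Num.max (- y 0 j) 0 * bid 0 j).

Definition super_replicates (R : realType) (d m : nat)
    (g : 'rV[R]_d -> 'rV[R]_m) (f : 'rV[R]_d -> R)
    (c : R) (y : 'rV[R]_m) : Prop :=
  forall x, orthant x -> f x <= c + dot y (g x).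

Definition phi (R : realType) (d m : nat) (ask bid : 'rV[R]_m)
    (g : 'rV[R]_d -> 'rV[R]_m) (f : 'rV[R]_d -> R) : \bar R :=
  ereal_inf [set (p.1 + price ask bid p.2)%:E |
             p in [set p : R * 'rV[R]_m | super_replicates g f p.1 p.2]]%classic.

Definition no_arbitrage (R : realType) (d m : nat) (ask bid : 'rV[R]_m)
    (g : 'rV[R]_d -> 'rV[R]_m) : Prop :=
  forall y : 'rV[R]_m,
    (forall x, orthant x -> 0 <= dot y (g x) - price ask bid y) ->
    (forall x, orthant x -> dot y (g x) - price ask bid y = 0).

Definition slack (R : realType) (d m : nat) (g : 'rV[R]_d -> 'rV[R]_m)
    (f : 'rV[R]_d -> R) (y : 'rV[R]_m) (x : 'rV[R]_d) : R :=
  dot y (g x) - f x.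

(** * Radial constraints *)

(* Data of a representation
     z |-> \sum_k (<y, w_k> + z_k) * max_i <a_(k, i), z>
   of the radial functions of the slacks, uniform in y. *)
Record slack_rep (R : realType) (d m : nat) := SlackRep {
  sr_size : nat;
  sr_pieces : 'I_sr_size -> nat;
  sr_slope : forall k, 'I_(sr_pieces k).+1 -> 'rV[R]_d;
  sr_w : 'I_sr_size -> 'rV[R]_m;
  sr_z : 'I_sr_size -> R }.

Definition sr_coef (R : realType) (d m : nat) (S : slack_rep R d m)
    (y : 'rV[R]_m) (k : 'I_(sr_size S)) : R :=
  dot y (sr_w k) + sr_z k.

Definition sr_val (R : realType) (d m : nat) (S : slack_rep R d m)
    (y : 'rV[R]_m) (z : 'rV[R]_d) : R :=
  \sum_(k < sr_size S) sr_coef y k *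
    fmax (fun i : 'I_(sr_pieces k).+1 => dot (sr_slope i) z).

Definition multi_index (R : realType) (d m : nat) (S : slack_rep R d m) : Type :=
  {dffun forall k : 'I_(sr_size S), 'I_(sr_pieces k).+1}.

Definition diff_set (R : realType) (d m : nat) (S : slack_rep R d m)
    (i : multi_index S) : {fset 'rV[R]_d} :=
  [fset v in [seq sr_slope (i k) - sr_slope j |
               k <- enum 'I_(sr_size S),
               j <- [seq j <- enum 'I_(sr_pieces k).+1 | j != i k]]
          | v != 0]%fset.

(* There are weights eta >= 0 on A of total mass 1 with
   \sum_v eta_v v <= 0; values of eta outside A are irrelevant. *)
Definition has_nonpos_average (R : realType) (d : nat)
    (A : {fset 'rV[R]_d}) : Prop :=
  exists eta : 'rV[R]_d -> R,
    [/\ forall v, v \in A -> 0 <= eta v,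
        \sum_(v <- A) eta v = 1
      & lev (\sum_(v <- A) eta v *: v) 0].

(* The auxiliary variables are eta i v for v \in diff_set i and i not
   satisfying has_nonpos_average; other values of eta are unconstrained. *)
Definition radial_system (R : realType) (d m : nat) (S : slack_rep R d m)
    (y : 'rV[R]_m) (eta : multi_index S -> 'rV[R]_d -> R) : Prop :=
  forall i : multi_index S, ~ has_nonpos_average (diff_set i) ->
    (forall v, v \in diff_set i -> 0 <= eta i v) /\
    lev (\sum_(v <- diff_set i) eta i v *: v)
        (\sum_(k < sr_size S) sr_coef y k *: sr_slope (i k)).

(** * The exterior cutting plane algorithm *)

(* in_c0 and in_y0 only enter through the a priori bound [phi_low]. *)
Record ecp_input (R : realType) (d m : nat) := EcpInput {
  in_ask : 'rV[R]_m;
  in_bid : 'rV[R]_m;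
  in_g : 'rV[R]_d -> 'rV[R]_m;
  in_f : 'rV[R]_d -> R;
  in_rep : slack_rep R d m;
  in_X0 : {fset 'rV[R]_d};
  in_eps : R;
  in_tau : R;
  in_delta : R;
  in_xbar : 'rV[R]_d;
  in_c0 : R;
  in_y0 : 'rV[R]_m }.

Definition phi_low (R : realType) (d m : nat) (P : ecp_input R d m) : R :=
  - in_c0 P - price (in_ask P) (in_bid P) (in_y0 P).

Record lp_point (R : realType) (d m : nat) (P : ecp_input R d m) := LpPoint {
  lp_c : R;
  lp_y : 'rV[R]_m;
  lp_yp : 'rV[R]_m;
  lp_ym : 'rV[R]_m;
  lp_eta : multi_index (in_rep P) -> 'rV[R]_d -> R }.

Definition lp_obj (R : realType) (d m : nat) (P : ecp_input R d m)
    (p : lp_point P) : R :=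
  lp_c p + dot (lp_yp p) (in_ask P) - dot (lp_ym p) (in_bid P).

Definition lp_feasible (R : realType) (d m : nat) (P : ecp_input R d m)
    (X : {fset 'rV[R]_d}) (p : lp_point P) : Prop :=
  [/\ radial_system (lp_y p) (lp_eta p),
      lev 0 (lp_yp p) /\ lev 0 (lp_ym p),
      lp_y p = lp_yp p - lp_ym p,
      phi_low P - in_tau P <= lp_obj p
    & forall x, x \in X ->
        in_f P x <= lp_c p + dot (lp_yp p - lp_ym p) (in_g P x)].

Definition lp_minimizer (R : realType) (d m : nat) (P : ecp_input R d m)
    (X : {fset 'rV[R]_d}) (p : lp_point P) : Prop :=
  lp_feasible X p /\
  forall q : lp_point P, lp_feasible X q -> lp_obj p <= lp_obj q.

(* One pass through the loop: it_X, it_sol, it_s and it_next are X^(r), the LP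
   solution, s^(r) and X^(r+1). *)
Record iterate (R : realType) (d m : nat) (P : ecp_input R d m) := Iterate {
  it_X : {fset 'rV[R]_d};
  it_sol : lp_point P;
  it_s : R;
  it_next : {fset 'rV[R]_d} }.

Definition it_phi (R : realType) (d m : nat) (P : ecp_input R d m)
    (it : iterate P) : R := lp_obj (it_sol it).

Definition it_c (R : realType) (d m : nat) (P : ecp_input R d m)
    (it : iterate P) : R := lp_c (it_sol it).

Definition it_y (R : realType) (d m : nat) (P : ecp_input R d m)
    (it : iterate P) : 'rV[R]_m := lp_yp (it_sol it) - lp_ym (it_sol it).

(* A history [:: it_0; ...; it_(r-1)] lists the completed iterations. *)
Definition cuts (R : realType) (d m : nat) (P : ecp_input R d m)
    (h : seq (iterate P)) : {fset 'rV[R]_d} :=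
  (\bigcup_(it <- h) it_X it)%fset.

Definition next_cuts (R : realType) (d m : nat) (P : ecp_input R d m)
    (h : seq (iterate P)) : {fset 'rV[R]_d} :=
  last (in_X0 P) [seq it_next it | it <- h].

Definition slack_minimizer (R : realType) (d m : nat) (P : ecp_input R d m)
    (y : 'rV[R]_m) (x : 'rV[R]_d) : Prop :=
  box (in_xbar P) x /\
  forall x', box (in_xbar P) x' ->
    slack (in_g P) (in_f P) y x <= slack (in_g P) (in_f P) y x'.

(* [it] is a possible outcome of the loop body after the history h.  The LP
   minimizer and the finite set [found] of points found by the solver are
   arbitrary, apart from what is required of them. *)
Definition iteration (R : realType) (d m : nat) (P : ecp_input R d m)
    (h : seq (iterate P)) (it : iterate P) : Prop :=
  let s := slack (in_g P) (in_f P) (it_y it) in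
  [/\ it_X it = next_cuts h,
      lp_minimizer (cuts (rcons h it)) (it_sol it),
      exists2 x, slack_minimizer P (it_y it) x & it_s it = it_c it + s x
    & exists found : {fset 'rV[R]_d},
        [/\ forall x, x \in found -> box (in_xbar P) x,
            exists2 x, x \in found & slack_minimizer P (it_y it) x
          & it_next it =
            [fset x in found | (it_c it + s x <= in_delta P * it_s it)%R]%fset]].

Definition stopped (R : realType) (d m : nat) (P : ecp_input R d m)
    (h : seq (iterate P)) : Prop :=
  exists h' it, h = rcons h' it /\ - in_eps P <= it_s it.

Inductive ecp_run (R : realType) (d m : nat) (P : ecp_input R d m) :
    seq (iterate P) -> Prop :=
| RunStart : ecp_run [::]
| RunStep h it :
    ecp_run h -> ~ stopped h -> iteration h it -> ecp_run (rcons h it).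

Inductive ecp_result (R : realType) (d m : nat) :=
| ReportUnbounded
| ReturnSolution (UB LB c : R) (y : 'rV[R]_m) (X : {fset 'rV[R]_d}).
Arguments ReportUnbounded {R d m}.

Definition final_result (R : realType) (d m : nat) (P : ecp_input R d m)
    (h : seq (iterate P)) (it : iterate P) : ecp_result R d m :=
  let UB := it_phi it - it_s it in
  if UB < phi_low P then ReportUnbounded
  else ReturnSolution UB (it_phi it) (it_c it - it_s it) (it_y it)
         (cuts (rcons h it)).

Definition ecp_terminates (R : realType) (d m : nat) (P : ecp_input R d m)
    (res : ecp_result R d m) : Prop :=
  exists (h : seq (iterate P)) (it : iterate P),
    [/\ ecp_run (rcons h it), - in_eps P <= it_s it & res = final_result h it].

(* Main.v *)
Require Import Defs.
From mathcomp Require Import all_boot all_order all_algebra finmap.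
From mathcomp Require Import all_classical all_reals ereal.
From mathcomp Require Import topology normedtype sequences.
From mathcomp Require Import ring lra.

(** Everything rests on the elimination of variables in finite systems of linear
    inequalities and on one compactness argument.

    Eliminating variables (polyhedral_exists) shows that a projection of a
    polyhedron is a polyhedron.  Three consequences follow.  A linear program
    that is feasible and bounded below attains its minimum, because the set of
    its values is a polyhedron of the line; so every iteration can be performed.
    A finitely generated cone is a polyhedron, which gives Farkas' lemma.  A
    projection of a polyhedron is closed.

    Farkas' lemma identifies the radial constraints.  A slack differs from its
    radial function by a bounded amount, and the radial function is positively
    homogeneous; hence the slack of y is bounded below on the orthant if and
    only if its radial function is nonnegative there.  On the cone where a given
    multi-index of pieces is active the radial function is linear, and its
    nonnegativity on that cone is the existence of the multipliers eta.  The
    cones that are left out of the system contain no generic point, so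
    nonnegativity on the other ones extends to the orthant by continuity
    (radial_system_exists, sr_val_ge0_of_radial).  Consequently the slack of an
    LP solution has the same minimum over the box as over the orthant, and
    subtracting it_s from the cash of that solution makes it a
    super-replicating portfolio.  Conversely each super-replicating portfolio is
    feasible for every LP once its price is at least phi_low, which is what the
    absence of arbitrage ensures when the portfolio is combined with the one
    that dominates - f.  These two remarks give the bounds on phi; a reported
    price below phi_low makes the same combination an arbitrage, and adding
    large multiples of it to a super-replicating portfolio drives the price to
    -oo.

    Finiteness of the iteration (cutting_planes_stop) is proved by
    contradiction.  The LP solutions themselves may be unbounded, so the payoff
    functions c + <y, g> are used instead: they are determined linearly by their
    values at finitely many points of the orthant (finite_determination).  The
    vectors of these values, divided by their norm plus one, stay in a compact
    set.  In the limit, the cut made at each violated point and the size of the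
    violation exclude bounded sequences; in the unbounded case the limit is a
    nonzero payoff that is nonnegative on the orthant and has a price at most 0.
    A portfolio of price at most 0 realizes it, because the values of the
    payoffs of such portfolios form a polyhedron, hence a closed set; this
    contradicts the absence of arbitrage. *)

Set Implicit Arguments.
Unset Strict Implicit.
Unset Printing Implicit Defensive.

Import Order.TTheory GRing.Theory Num.Theory.
Import numFieldNormedType.Exports.
Local Open Scope ring_scope.

(** * Linear inequalities and the elimination of variables *)

(** Affine maps are those that respect affine combinations of two points; this
    form composes without mentioning a linear part. *)
Definition affine (R : realType) (V W : lmodType R) (phi : V -> W) : Prop :=
  forall (a : R) x y,
    phi (a *: x + (1 - a) *: y) = a *: phi x + (1 - a) *: phi y.

(** The predicate is inductive so that its closure properties are proved by
    induction on the inequalities. *)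
Inductive polyhedral (R : realType) (V : lmodType R) : (V -> Prop) -> Prop :=
| PolyhedralFull : polyhedral (fun _ => True)
| PolyhedralCut (phi : V -> R^o) S :
    affine phi -> polyhedral S -> polyhedral (fun x => 0 <= phi x /\ S x).

Section Polyhedra.
Variable R : realType.
Implicit Types V W : lmodType R.

Lemma polyhedral_ext V (S T : V -> Prop) :
  (forall x, S x <-> T x) -> polyhedral S -> polyhedral T.
Proof.
by move=> ST pS; suff <- : S = T by []; apply/funext => x; exact/propext.
Qed.

Lemma polyhedral_ge0 V (phi : V -> R^o) :
  affine phi -> polyhedral (fun x => 0 <= phi x).
Proof.
move=> aphi; apply: polyhedral_ext (PolyhedralCut aphi (PolyhedralFull V)).
by move=> x; split=> [[]|].
Qed.

Lemma polyhedral_and V (S T : V -> Prop) :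
  polyhedral S -> polyhedral T -> polyhedral (fun x => S x /\ T x).
Proof.
move=> pS pT; elim: S / pS => [|phi S aphi _ IH].
  by apply: polyhedral_ext pT => x; split=> [|[]].
by apply: polyhedral_ext (PolyhedralCut aphi IH) => x; rewrite and_assoc.
Qed.

Lemma polyhedral_imply V (Q : Prop) (S : V -> Prop) :
  polyhedral S -> polyhedral (fun x => Q -> S x).
Proof.
move=> pS; have [q|nq] := pselect Q.
  by apply: polyhedral_ext pS => x; split=> // /(_ q).
by apply: polyhedral_ext (PolyhedralFull V) => x; split.
Qed.

Lemma polyhedral_all V (T : eqType) (s : seq T) (S : T -> V -> Prop) :
  (forall i, polyhedral (S i)) ->
  polyhedral (fun x => forall i, i \in s -> S i x).
Proof.
move=> pS; elim: s => [|i s IH].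
  by apply: polyhedral_ext (PolyhedralFull V) => x; split.
apply: polyhedral_ext (polyhedral_and (pS i) IH) => x; split.
  by move=> [Si Ss] j; rewrite inE => /predU1P[->|/Ss].
move=> h; split; first by apply: h; rewrite mem_head.
by move=> j js; apply: h; rewrite inE js orbT.
Qed.

Lemma polyhedral_forall V (I : finType) (S : I -> V -> Prop) :
  (forall i, polyhedral (S i)) -> polyhedral (fun x => forall i, S i x).
Proof.
move=> /(polyhedral_all (enum I)); apply: polyhedral_ext => x.
by split=> h i => [|_]; apply: h => //; rewrite mem_enum.
Qed.

Lemma polyhedral_preim V W (psi : V -> W) (S : W -> Prop) :
  affine psi -> polyhedral S -> polyhedral (fun x => S (psi x)).
Proof.
move=> apsi; elim: S / => [|phi S aphi _ IH]; first exact: PolyhedralFull.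
by apply: (PolyhedralCut (phi := phi \o psi)) => // a x y /=; rewrite apsi aphi.
Qed.

Lemma linear_affine V W (phi : V -> W) : linear phi -> affine phi.
Proof.
move=> l a x y; rewrite l; congr (_ + _).
have phi0 : phi 0 = 0.
  by have := l (-1) 0 0; rewrite scaler0 add0r scaleN1r addNr.
by rewrite -[(1 - a) *: y]addr0 l phi0 addr0.
Qed.

Lemma affine_add V W (phi psi : V -> W) :
  affine phi -> affine psi -> affine (fun x => phi x + psi x).
Proof. by move=> hp hs a x y; rewrite hp hs !scalerDr addrACA. Qed.

Lemma affine_opp V W (phi : V -> W) : affine phi -> affine (fun x => - phi x).
Proof. by move=> hp a x y; rewrite hp opprD !scalerN. Qed.

Lemma affine_cst V W (w : W) : affine (fun _ : V => w).
Proof. by move=> a x y; rewrite -scalerDl subrKC scale1r. Qed.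

Lemma affine_comp (U V W : lmodType R) (phi : V -> W) (psi : U -> V) :
  affine phi -> affine psi -> affine (fun x => phi (psi x)).
Proof. by move=> hp hs a x y; rewrite hs hp. Qed.

Lemma affine_scale V (v : V) : affine (fun t : R^o => (t : R) *: v).
Proof.
have E (a x y : R) :
    (a * x + (1 - a) * y) *: v = a *: (x *: v) + (1 - a) *: (y *: v).
  by rewrite scalerDl !scalerA.
exact: E.
Qed.

Lemma affine_pair (U V W : lmodType R) (phi : U -> V) (psi : U -> W) :
  affine phi -> affine psi -> affine (fun x => (phi x, psi x)).
Proof. by move=> hp hs a x y; rewrite hp hs. Qed.

Lemma affine_dot n (a : 'rV[R]_n) : affine (fun u => dot u a : R^o).
Proof.
apply: linear_affine => t x y; rewrite /dot scaler_sumr -big_split /=.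
by apply: eq_bigr => i _; rewrite !mxE mulrDl -scalerAl.
Qed.

Lemma affine_coord n (i : 'I_n) : affine (fun u : 'rV[R]_n => u 0 i : R^o).
Proof. by move=> a x y; rewrite !mxE. Qed.

Lemma polyhedral_le V (phi psi : V -> R^o) :
  affine phi -> affine psi -> polyhedral (fun x => phi x <= psi x).
Proof.
move=> hp hs; 
apply: polyhedral_ext (polyhedral_ge0 (affine_add hs (affine_opp hp))).
by move=> x; rewrite subr_ge0.
Qed.

Lemma polyhedral_lev V n (phi psi : V -> 'rV[R]_n) :
  affine phi -> affine psi -> polyhedral (fun x => lev (phi x) (psi x)).
Proof.
move=> hp hs; apply: polyhedral_forall => i.
by apply: polyhedral_le; apply: affine_comp (affine_coord i) _.
Qed.

Lemma polyhedral_eq V (phi psi : V -> R^o) :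
  affine phi -> affine psi -> polyhedral (fun x => phi x = psi x).
Proof.
move=> hp hs.
apply: polyhedral_ext (polyhedral_and (polyhedral_le hp hs) (polyhedral_le hs hp)).
by move=> x; split=> [[h1 h2]|->//]; apply: le_anti; rewrite h1 h2.
Qed.

(** The constraints on a pair (x, t) sort themselves by the sign of the
    coefficient of t: lower bounds on t, upper bounds on t, and constraints on x
    alone. *)
Lemma polyhedral_bounds V (S : V * R^o -> Prop) : polyhedral S ->
  exists (Q : V -> Prop) (nl nu : nat) (lo : 'I_nl -> V -> R^o)
      (up : 'I_nu -> V -> R^o),
    [/\ polyhedral Q, forall i, affine (lo i), forall j, affine (up j)
      & forall x t, S (x, t) <->
          [/\ Q x, forall i, lo i x <= t & forall j, t <= up j x]].
Proof.
elim: S / => [|phi S aphi _ [Q [nl [nu [lo [up [pQ alo aup hS]]]]]]].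
  exists (fun=> True), 0%N, 0%N, (fun _ _ => 0), (fun _ _ => 0).
  split; [exact: PolyhedralFull | by case | by case |].
  by move=> x t; split=> // _; split=> // -[].
pose b : R := phi (0, 1) - phi (0, 0).
have phiD (a : R) x y (s t : R) :
    phi (a *: x + (1 - a) *: y, a * s + (1 - a) * t) =
    a * phi (x, s) + (1 - a) * phi (y, t).
  exact: (aphi a (x, s) (y, t)).
(* (x, t) is the midpoint of (2 x, 0) and (0, 2 t) *)
have phiE x (t : R) : phi (x, t) = phi (x, 0) + b * t.
  have := phiD 2^-1 (2%:R *: x) 0 0 (2%:R * t).
  have := phiD 2%:R x 0 0 0.
  have := phiD (2%:R * t) 0 0 1 0.
  rewrite !scaler0 !mulr0 !addr0 add0r mulr1 => -> ->.
  rewrite scalerA mulVf ?pnatr_eq0// scale1r.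
  have -> : (1 - 2^-1) * (2%:R * t) = t by field.
  by rewrite /b => ->; field.
have a0 : affine (fun x => phi (x, 0)).
  apply: (affine_comp aphi); apply: affine_pair; first by move=> ? ? ?.
  exact: affine_cst.
have adiv : affine (fun x => - (b^-1 *: phi (x, 0))).
  by apply: affine_opp => a x y; rewrite a0 scalerDr !scalerA ![b^-1 * _]mulrC.
have cutE x t : (0 <= phi (x, t) /\ S (x, t)) <->
   [/\ 0 <= phi (x, 0) + b * t, Q x,
       forall i, lo i x <= t & forall j, t <= up j x].
  rewrite phiE hS; split; first by case=> ? [].
  by case=> ? ? ? ?.
have [b0|b0|b0] := ltgtP b 0.
- exists Q, nl, nu.+1, lo,
    (fun j => if unlift ord0 j is Some j' then up j'
              else fun x => - (b^-1 *: phi (x, 0))).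
  split=> // [j|x t]; first by case: unliftP.
  have key : (0 <= phi (x, 0) + b * t) = (t <= - (b^-1 *: phi (x, 0))).
    rewrite -[RHS](ler_nM2l b0) mulrN mulrA divff ?lt_eqF// mul1r.
    by rewrite -[RHS]subr_ge0 opprK addrC.
  rewrite cutE key; split.
    by case=> h1 ? ? h2; split=> // j; case: unliftP.
  case=> ? ? h; split=> //; first by have := h ord0; rewrite unlift_none.
  by move=> j; have := h (lift ord0 j); rewrite liftK.
- exists Q, nl.+1, nu,
    (fun j => if unlift ord0 j is Some j' then lo j'
              else fun x => - (b^-1 *: phi (x, 0))), up.
  split=> // [j|x t]; first by case: unliftP.
  have key : (0 <= phi (x, 0) + b * t) = (- (b^-1 *: phi (x, 0)) <= t).
    rewrite -[RHS](ler_pM2l b0) mulrN mulrA divff ?gt_eqF// mul1r.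
    by rewrite -[RHS]subr_ge0 opprK addrC.
  rewrite cutE key; split.
    by case=> h1 ? h2 ?; split=> // j; case: unliftP.
  case=> ? h ?; split=> //; first by have := h ord0; rewrite unlift_none.
  by move=> j; have := h (lift ord0 j); rewrite liftK.
- exists (fun x => 0 <= phi (x, 0) /\ Q x), nl, nu, lo, up.
  split=> // [|x t]; first exact: PolyhedralCut.
  rewrite cutE b0 mul0r addr0; split; first by case=> ? ? ? ?.
  by case=> -[? ?] ? ?.
Qed.

(** Fourier-Motzkin elimination: a value of the eliminated variable exists as
    soon as each lower bound is below each upper bound, because there are
    finitely many of them. *)
Lemma polyhedral_exists V (S : V * R^o -> Prop) : polyhedral S ->
  polyhedral (fun x => exists t : R, S (x, t)).
Proof.
move=> /polyhedral_bounds[Q [nl [nu [lo [up [pQ alo aup hS]]]]]].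
have : polyhedral (fun x => Q x /\ forall i j, lo i x <= up j x).
  apply: polyhedral_and => //; apply: polyhedral_forall => i.
  by apply: polyhedral_forall => j; exact: polyhedral_le.
apply: polyhedral_ext => x; split; last first.
  move=> [t /hS[Qx hl hu]]; split=> // i j; exact: le_trans (hl i) (hu j).
move=> [Qx lu].
case: nl lo alo hS lu => [|nl] lo alo hS lu.
  case: nu up aup hS lu => [|nu] up aup hS lu.
    by exists 0; apply/hS; split=> // -[].
  exists (\big[Num.min/up ord0 x]_j up j x); apply/hS.
  by split=> // [[]//|j]; exact: bigmin_le_cond.
exists (\big[Num.max/lo ord0 x]_i lo i x); apply/hS; split=> // [i|j].
  exact: le_bigmax.
by apply/bigmax_leP; split.
Qed.

Lemma polyhedral_exists_rV V n (S : V * 'rV[R]_n -> Prop) : polyhedral S ->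
  polyhedral (fun x => exists u : 'rV[R]_n, S (x, u)).
Proof.
elim: n S => [|n IH] S pS.
  apply: (@polyhedral_ext _ (fun x => S (x, 0))).
    by move=> x; split=> [|[u]]; [exists 0 | rewrite (thinmx0 u)].
  apply: polyhedral_preim pS; apply: affine_pair; last exact: affine_cst.
  by move=> ? ? ?.
pose psi (p : (V * 'rV[R]_n) * R^o) : V * 'rV[R]_(1 + n) :=
  (p.1.1, row_mx (p.2%:M : 'rV_1) p.1.2).
have apsi : affine psi.
  apply: affine_pair; first by move=> ? ? ?.
  move=> a x y; apply/rowP => i; rewrite !mxE.
  by case: (fintype.split i) => j; rewrite !mxE // !ord1 eqxx !mulr1n.
have := IH _ (polyhedral_exists (polyhedral_preim apsi pS)).
apply: polyhedral_ext => x; split=> [[u [t h]]|[u h]].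
  by exists (row_mx t%:M u).
exists (rsubmx (u : 'rV_(1 + n))), (lsubmx (u : 'rV_(1 + n)) 0 0).
by rewrite /psi /= -mx11_scalar hsubmxK.
Qed.

End Polyhedra.

(** * Attained minima, separation and Farkas' lemma *)

Section PolyhedraFiniteDim.
Variable R : realType.

Lemma dotC n (x y : 'rV[R]_n) : dot x y = dot y x.
Proof. by apply: eq_bigr => i _; rewrite mulrC. Qed.

Lemma dotDl n (x y z : 'rV[R]_n) : dot (x + y) z = dot x z + dot y z.
Proof.
by rewrite /dot -big_split; apply: eq_bigr => i _; rewrite mxE mulrDl.
Qed.

Lemma dotZl n a (x z : 'rV[R]_n) : dot (a *: x) z = a * dot x z.
Proof. by rewrite /dot mulr_sumr; apply: eq_bigr => i _; rewrite mxE mulrA. Qed.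

Lemma dotNl n (x z : 'rV[R]_n) : dot (- x) z = - dot x z.
Proof. by rewrite -scaleN1r dotZl mulN1r. Qed.

Lemma dotBl n (x y z : 'rV[R]_n) : dot (x - y) z = dot x z - dot y z.
Proof. by rewrite dotDl dotNl. Qed.

Lemma dot0l n (z : 'rV[R]_n) : dot 0 z = 0.
Proof. by rewrite -(scale0r 0) dotZl mul0r. Qed.

Lemma dotZr n a (x z : 'rV[R]_n) : dot x (a *: z) = a * dot x z.
Proof. by rewrite dotC dotZl dotC. Qed.

Lemma dot_suml n I (r : seq I) (F : I -> 'rV[R]_n) z :
  dot (\sum_(i <- r) F i) z = \sum_(i <- r) dot (F i) z.
Proof. by elim/big_ind2: _ => [|a b c e <- <-|//]; rewrite ?dot0l ?dotDl. Qed.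

Lemma dot_delta n (i : 'I_n) (z : 'rV[R]_n) : dot (delta_mx 0 i) z = z 0 i.
Proof.
rewrite /dot (bigD1 i)//= mxE !eqxx mul1r big1 ?addr0// => j /negPf ji.
by rewrite mxE ji andbF mul0r.
Qed.

Lemma dot_ge0 n (x z : 'rV[R]_n) : lev 0 x -> lev 0 z -> 0 <= dot x z.
Proof.
move=> x0 z0; apply: sumr_ge0 => i _.
by move: (x0 i) (z0 i); rewrite !mxE; exact: mulr_ge0.
Qed.

Lemma dot_levl n (x y z : 'rV[R]_n) : lev x y -> lev 0 z -> dot x z <= dot y z.
Proof.
move=> xy z0; rewrite -subr_ge0 -dotBl; apply: dot_ge0 => // i.
by have := xy i; rewrite !mxE subr_ge0.
Qed.

(** A polyhedron of the line is given by bounds, and one of its lower bounds is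
    reached. *)
Lemma polyhedral_minimum (S : R^o -> Prop) (b t0 : R) : polyhedral S ->
  S t0 -> (forall t, S t -> b <= t) ->
  exists2 t, S t & forall t', S t' -> t <= t'.
Proof.
move=> pS S0 Sb.
(* a dummy variable, so that the bounds on t become constants *)
have : polyhedral (fun p : R^o * R^o => S p.2).
  by apply: polyhedral_preim pS => ? ? ?.
move=> /polyhedral_bounds[Q [nl [nu [lo [up [_ _ _ hS]]]]]].
have {}hS t : S t <-> [/\ Q 0, forall i, lo i 0 <= t & forall j, t <= up j 0].
  exact: (hS 0 t).
have [Q0 hlo hup] := (hS t0).1 S0.
case: nl lo hS hlo => [|nl] lo hS hlo.
  have : S (Num.min t0 (b - 1)).
    by apply/hS; split=> // [[]//|j]; rewrite ge_min hup.
  by move=> /Sb; rewrite le_min lerBrDr gerDl ler10 andbF.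
exists (\big[Num.max/lo ord0 0]_i lo i 0); last first.
  by move=> t /hS[_ h _]; apply/bigmax_leP; split.
apply/hS; split=> // [i|j]; first exact: le_bigmax.
by apply: le_trans (hup j); apply/bigmax_leP; split.
Qed.

Lemma polyhedral_separation (V : lmodType R) (S : V -> Prop) (u : V) :
  polyhedral S -> ~ S u ->
  exists phi : V -> R^o,
    [/\ affine phi, phi u < 0 & forall x, S x -> 0 <= phi x].
Proof.
elim: S / => [|phi S aphi _ IH] // nS.
have [phiu|phiu] := leP 0 (phi u); last by exists phi; split=> // x [].
have [|psi [? ? h]] := IH; first by move=> Su; apply: nS.
by exists psi; split=> // x [_ /h].
Qed.

Lemma affine_rV n (phi : 'rV[R]_n -> R^o) : affine phi ->
  exists z, forall x, phi x = phi 0 + dot x z.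
Proof.
move=> aphi.
have hZ a x : phi (a *: x) - phi 0 = a * (phi x - phi 0).
  have := aphi a x 0; rewrite scaler0 addr0 => ->.
  by rewrite /GRing.scale /=; ring.
have hD x y : phi (x + y) - phi 0 = (phi x - phi 0) + (phi y - phi 0).
  have := aphi 2^-1 (2%:R *: x) (2%:R *: y).
  have -> : 2^-1 *: (2%:R *: x) + (1 - 2^-1) *: (2%:R *: y) = x + y.
    rewrite !scalerA mulVf ?pnatr_eq0// (_ : (1 - 2^-1) * 2%:R = 1) ?scale1r//.
    by field.
  have := hZ 2%:R x; have := hZ 2%:R y.
  move=> /(canRL (subrK _)) -> /(canRL (subrK _)) -> ->.
  by rewrite /GRing.scale /=; field.
exists (\row_i (phi (delta_mx 0 i) - phi 0)) => x.
apply/eqP; rewrite addrC -subr_eq; apply/eqP.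
rewrite {1}[x]row_sum_delta /dot.
rewrite (big_morph (fun u => phi u - phi 0) hD (subrr _)).
by apply: eq_bigr => i _; rewrite hZ mxE.
Qed.

(** The multipliers are quantified one at a time, so that each of them can be
    eliminated in turn; cone_leP gives the usual description. *)
Fixpoint cone_le d (A : seq 'rV[R]_d) (u : 'rV[R]_d) : Prop :=
  if A is v :: A' then exists t : R, 0 <= t /\ cone_le A' (u - t *: v)
  else lev 0 u.

Lemma polyhedral_cone_le d (A : seq 'rV[R]_d) : polyhedral (cone_le A).
Proof.
elim: A => [|v A IH] /=.
  by apply: polyhedral_lev => //; exact: affine_cst.
pose S (p : 'rV[R]_d * R^o) := 0 <= p.2 /\ cone_le A (p.1 - (p.2 : R) *: v).
apply: (@polyhedral_exists _ _ S); apply: polyhedral_and.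
  by apply: polyhedral_ge0 => ? ? ?.
apply: polyhedral_preim IH; apply: affine_add; first by move=> ? ? ?.
apply: affine_opp; apply: (affine_comp (affine_scale v)); by move=> ? ? ?.
Qed.

Lemma cone_le_nonneg d (A : seq 'rV[R]_d) u : lev 0 u -> cone_le A u.
Proof.
elim: A => //= v A IH u0.
by exists 0; split=> //; rewrite scale0r subr0; exact: IH.
Qed.

Lemma cone_le_generator d (A : seq 'rV[R]_d) v : v \in A -> cone_le A v.
Proof.
elim: A => //= w A IH; rewrite inE => /predU1P[<-|/IH vA].
  exists 1; split=> //; rewrite scale1r subrr; exact/cone_le_nonneg.
by exists 0; rewrite scale0r subr0.
Qed.

Lemma cone_le_scale d (A : seq 'rV[R]_d) u a :
  0 <= a -> cone_le A u -> cone_le A (a *: u).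
Proof.
move=> a0; elim: A u => /= [|v A IH] u.
  by move=> u0 i; have := u0 i; rewrite !mxE; exact: mulr_ge0.
move=> [t [t0 /IH]]; rewrite scalerBr scalerA => h.
by exists (a * t); rewrite mulr_ge0.
Qed.

Lemma cone_leP d (A : seq 'rV[R]_d) u : uniq A ->
  cone_le A u <-> exists eta : 'rV[R]_d -> R,
    (forall v, v \in A -> 0 <= eta v) /\ lev (\sum_(v <- A) eta v *: v) u.
Proof.
elim: A u => /= [|v A IH] u.
  move=> _; split=> [u0|[eta [_]]]; last by rewrite big_nil.
  by exists (fun=> 0); rewrite big_nil.
move=> /andP[vA uA]; split.
  move=> [t [t0 /(IH _ uA)[eta [eta0 h]]]].
  exists (fun w => if w == v then t else eta w); split.
    by move=> w; rewrite inE; case: eqP => //= _; exact: eta0.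
  rewrite big_cons eqxx => i.
  rewrite (eq_big_seq (fun w => eta w *: w)); last first.
    by move=> w wA; case: eqP => // wv; rewrite -wv wA in vA.
  by have := h i; rewrite !mxE lerBrDl.
move=> [eta [eta0]]; rewrite big_cons => h.
exists (eta v); split; first by rewrite eta0 ?mem_head.
apply/(IH _ uA); exists eta; split=> [w wA|i].
  by rewrite eta0// inE wA orbT.
by have := h i; rewrite !mxE lerBrDl.
Qed.

(** The cone is a polyhedron, so a point outside it violates one of its
    inequalities.  Since the cone is stable under scaling, the linear part of
    that inequality is nonnegative on the cone and serves as the separating z. *)
Lemma farkas d (A : seq 'rV[R]_d) (u : 'rV[R]_d) :
  (forall z, lev 0 z -> (forall v, v \in A -> 0 <= dot v z) -> 0 <= dot u z) ->
  cone_le A u.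
Proof.
move=> h; apply: contrapT => /(polyhedral_separation (polyhedral_cone_le A)).
move=> [phi [aphi phiu phiA]]; have [z phiE] := affine_rV aphi.
have phi0 : 0 <= phi 0 by apply/phiA/cone_le_nonneg.
have zA w : cone_le A w -> 0 <= dot w z.
  move=> wA; rewrite leNgt; apply/negP => wz.
  (* the multiple of w at which phi takes the value -1 *)
  pose s : R := (phi 0 + 1) / - dot w z.
  have s0 : 0 <= s by rewrite divr_ge0 ?addr_ge0// oppr_ge0 ltW.
  have := phiA _ (cone_le_scale s0 wA); rewrite phiE dotZl.
  have -> : s * dot w z = - (phi 0 + 1).
    by rewrite /s invrN mulrN mulNr divfK ?lt_eqF.
  by rewrite opprD addrA subrr add0r oppr_ge0 ler10.
have : 0 <= dot u z.
  apply: h => [i|v /cone_le_generator]; last exact: zA.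
  rewrite mxE -dot_delta; apply/zA/cone_le_nonneg => j.
  by rewrite !mxE; case: (_ && _).
rewrite leNgt => /negP; apply; rewrite phiE in phiu.
by apply: le_lt_trans phiu; rewrite lerDr.
Qed.

End PolyhedraFiniteDim.

(** * Limits along an ultrafilter *)

(** With an ultrafilter, any number of bounded sequences converge at once,
    without passing to common subsequences. *)
Section UltraLimits.
Local Open Scope classical_set_scope.
Variables (R : realType) (U : set_system nat).
Hypotheses (ultraU : UltraFilter U) (tailU : \oo `<=` U).
Local Notation "a ~~> l" := (a @ U --> (l : R)) (at level 70).

Lemma ultralimit_tail (n : nat) (Q : nat -> Prop) :
  (forall r, (n <= r)%N -> Q r) -> \forall r \near U, Q r.
Proof. by move=> h; apply: tailU; exists n. Qed.

Lemma ultralimit_exists (a : nat -> R) (M : R) :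
  (forall r, `|a r| <= M) -> exists l, a ~~> l.
Proof.
move=> aM.
have : (a @ U) `[- M, M].
  by apply: (ultralimit_tail (n := 0)) => r _; rewrite /= in_itv /= -ler_norml.
move=> /(segment_compact _)[l [_ cl]]; exists l => B nB.
have [//|nUB] := in_ultra_setVsetC (a @^-1` B) ultraU.
by have [x [/= nBx Bx]] := cl (~` B) B nUB nB.
Qed.

Lemma ultralimit_dot n (a b : nat -> 'rV[R]_n) (la lb : 'rV[R]_n) :
  (forall i, (fun r => a r 0 i) ~~> la 0 i) ->
  (forall i, (fun r => b r 0 i) ~~> lb 0 i) ->
  (fun r => dot (a r) (b r)) ~~> dot la lb.
Proof.
move=> ha hb; rewrite /dot.
apply: cvg_big => [|i _]; first exact: add_continuous.
exact: cvgM.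
Qed.

Lemma ultralimit_rV n (a : nat -> 'rV[R]_n) (M : R) :
  (forall r i, `|a r 0 i| <= M) ->
  exists l : 'rV[R]_n, forall i, (fun r => a r 0 i) ~~> l 0 i.
Proof.
move=> aM.
have /choice[l hl] i : exists l : R, (fun r => a r 0 i) ~~> l.
  by apply: (@ultralimit_exists _ M) => r; exact: aM.
by exists (\row_i l i) => i; rewrite mxE.
Qed.

Lemma polyhedral_closed n (S : 'rV[R]_n -> Prop) (a : nat -> 'rV[R]_n)
    (l : 'rV[R]_n) :
  polyhedral S -> (forall i, (fun r => a r 0 i) ~~> l 0 i) ->
  (forall r, S (a r)) -> S l.
Proof.
move=> pS al; elim: S / pS => // phi S aphi _ IH h.
split; last by apply: IH => r; have [] := h r.
have [z phiE] := affine_rV aphi; rewrite phiE.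
have cvg_phi : (fun r => (phi 0 : R) + dot (a r) z) ~~> ((phi 0 : R) + dot l z).
  apply: cvgD; first exact: cvg_cst.
  by apply: ultralimit_dot => // i; exact: cvg_cst.
apply: (cvgr_to_ge cvg_phi).
by apply: (ultralimit_tail (n := 0)) => r _; rewrite -phiE; have [] := h r.
Qed.

End UltraLimits.

(** * Signed sums of maxima of affine functions *)

Section MaxSums.
Variable R : realType.

Lemma fmax_ge n (F : 'I_n.+1 -> R) i : F i <= fmax F.
Proof. exact: le_bigmax. Qed.

Lemma fmax_le n (F : 'I_n.+1 -> R) c : (forall i, F i <= c) -> fmax F <= c.
Proof. by move=> h; apply/bigmax_leP; split. Qed.

Lemma fmax_eq n (F : 'I_n.+1 -> R) i : (forall j, F j <= F i) -> fmax F = F i.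
Proof. by move=> h; apply/le_anti; rewrite fmax_ge fmax_le. Qed.

Lemma fmax_attained n (F : 'I_n.+1 -> R) : exists i, forall j, F j <= F i.
Proof.
exists [arg max_(i > ord0) F i]%O.
by case: Order.TotalTheory.arg_maxP => // i _ h j; exact: h.
Qed.

Lemma fmax_dist n (F G : 'I_n.+1 -> R) e :
  (forall i, `|F i - G i| <= e) -> `|fmax F - fmax G| <= e.
Proof.
have half (A B : 'I_n.+1 -> R) :
    (forall i, `|A i - B i| <= e) -> fmax A - fmax B <= e.
  move=> h; rewrite lerBlDr; apply: fmax_le => i.
  rewrite -lerBlDr; apply: le_trans (h i); apply: le_trans (ler_norm _).
  by rewrite lerB// fmax_ge.
move=> h; rewrite ler_norml half// andbT lerNl opprB half// => i.
by rewrite distrC.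
Qed.

(** Common source of the Lipschitz bounds and of the bounded distance between a
    CPWA function and its radial function. *)
Lemma maxsum_dist K (p : 'I_K -> nat) (xi : 'I_K -> R)
    (F G : forall k, 'I_(p k).+1 -> R) (e : forall k, 'I_(p k).+1 -> R) :
  (forall k i, `|F k i - G k i| <= e k i) ->
  `|\sum_k xi k * fmax (F k) - \sum_k xi k * fmax (G k)|
    <= \sum_k `|xi k| * \sum_i e k i.
Proof.
move=> h; rewrite -sumrB; apply: le_trans (ler_norm_sum _ _ _) _.
apply: ler_sum => k _; rewrite -mulrBr normrM ler_wpM2l//.
apply: fmax_dist => i; apply: le_trans (h k i) _.
rewrite (bigD1 i)//= lerDl sumr_ge0// => j _.
exact: le_trans (h k j).
Qed.

Lemma dot_dist n (a x x' : 'rV[R]_n) e :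
  (forall i, `|x 0 i - x' 0 i| <= e) ->
  `|dot a x - dot a x'| <= (\sum_i `|a 0 i|) * e.
Proof.
move=> h; rewrite /dot -sumrB; apply: le_trans (ler_norm_sum _ _ _) _.
rewrite mulr_suml; apply: ler_sum => i _.
by rewrite -mulrBr normrM ler_wpM2l.
Qed.

(** The bound e on the coordinates stands for the maximum norm of x - x'. *)
Definition lipschitz_rV n (h : 'rV[R]_n -> R) : Prop :=
  exists2 C : R, 0 <= C & forall (x x' : 'rV[R]_n) (e : R), 0 <= e ->
    (forall i, `|x 0 i - x' 0 i| <= e) -> `|h x - h x'| <= C * e.

Lemma maxsum_lipschitz n K (p : 'I_K -> nat) (xi : 'I_K -> R)
    (a : forall k, 'I_(p k).+1 -> 'rV[R]_n) (b : forall k, 'I_(p k).+1 -> R) :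
  lipschitz_rV (fun x => \sum_k xi k * fmax (fun i => dot (a k i) x + b k i)).
Proof.
exists (\sum_k `|xi k| * \sum_i \sum_j `|a k i 0 j|).
  apply: sumr_ge0 => k _; rewrite mulr_ge0// sumr_ge0// => i _.
  exact: sumr_ge0.
move=> x x' e e0 xx'.
apply: (le_trans (maxsum_dist (e := fun k i => (\sum_j `|a k i 0 j|) * e) _ _)).
  by move=> k i; rewrite opprD addrACA subrr addr0; exact: dot_dist.
rewrite mulr_suml; apply: ler_sum => k _.
by rewrite -mulrA mulr_suml.
Qed.

Lemma cpwa_lipschitz d (r : cpwa R d) : lipschitz_rV (cpwa_val r).
Proof. exact: maxsum_lipschitz. Qed.

Lemma sr_val_lipschitz d m (S : slack_rep R d m) y : lipschitz_rV (sr_val S y).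
Proof.
have := maxsum_lipschitz (sr_coef y) (@sr_slope R d m S) (fun _ _ => 0).
set h := (fun x => _); suff -> : h = sr_val S y by [].
rewrite /h; apply/funext => x; apply: eq_bigr => k _.
by congr (_ * fmax _); apply/funext => i; rewrite addr0.
Qed.

Lemma cpwa_radial_dist d (r : cpwa R d) :
  exists C : R, forall x, `|cpwa_val r x - cpwa_radial r x| <= C.
Proof.
exists (\sum_k `|(-1) ^+ cp_neg k : R| *
  \sum_(i < (cp_pieces k).+1) `|@cp_const R d r k i|).
move=> x; apply: (@maxsum_dist _ (@cp_pieces R d r)) => k i.
by rewrite addrAC subrr add0r.
Qed.

Lemma box_orthant d (b x : 'rV[R]_d) : box b x -> orthant x.
Proof. by case. Qed.

Lemma box_dist0 d (b x : 'rV[R]_d) : lev 0 b -> box b x ->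
  forall i, `|x 0 i - (0 : 'rV[R]_d) 0 i| <= \sum_j b 0 j.
Proof.
move=> b0 [x0 xb] i; have := x0 i; rewrite !mxE subr0 => xi0.
rewrite ger0_norm//; apply: le_trans (xb i) _.
rewrite (bigD1 i)//= lerDl sumr_ge0// => j _.
by have := b0 j; rewrite mxE.
Qed.

Lemma lipschitz_box_bounded d (b : 'rV[R]_d) h : lipschitz_rV h -> lev 0 b ->
  exists M : R, forall x, box b x -> `|h x| <= M.
Proof.
move=> [C C0 hC] b0; exists (`|h 0| + C * \sum_j b 0 j) => x bx.
rewrite -[h x](subrK (h 0)) addrC; apply: le_trans (ler_normD _ _) _.
rewrite lerD2l; apply: hC; last exact: box_dist0.
by apply: sumr_ge0 => j _; have := b0 j; rewrite mxE.
Qed.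

Local Open Scope classical_set_scope.

Lemma tail_ultrafilter : exists U : set_system nat, UltraFilter U /\ \oo `<=` U.
Proof. exact: ultraFilterLemma. Qed.

(** The limit of a minimizing sequence. *)
Lemma box_minimum d (b : 'rV[R]_d) (h : 'rV[R]_d -> R) :
  lipschitz_rV h -> lev 0 b ->
  exists2 x, box b x & forall x', box b x' -> h x <= h x'.
Proof.
move=> hlip b0; have [M hM] := lipschitz_box_bounded hlip b0.
have [C C0 hC] := hlip.
pose A : set R := h @` box b.
have infA : has_inf A.
  split; first by exists (h 0), 0 => //; split=> // i; rewrite mxE.
  exists (- M) => _ [x bx <-].
  by have := hM _ bx; rewrite ler_norml => /andP[].
have /choice[x hx] n : exists x, box b x /\ h x <= inf A + n.+1%:R^-1.
  have e0 : 0 < n.+1%:R^-1 :> R by rewrite invr_gt0.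
  have [_ [x bx <-] hx] := inf_adherent e0 infA.
  by exists x; split=> //; exact: ltW.
have [U [ultraU tailU]] := tail_ultrafilter.
have [|l xl] :=
    ultralimit_rV (n := d) ultraU tailU (a := x) (M := \sum_j b 0 j).
  by move=> r i; have := box_dist0 b0 (hx r).1 i; rewrite mxE subr0.
have bl : box b l.
  split=> i.
    rewrite mxE; apply: (cvgr_to_ge (xl i)).
    apply: (ultralimit_tail tailU (n := 0)) => r _.
    by have := (hx r).1.1 i; rewrite mxE.
  apply: (cvgr_to_le (xl i)).
  by apply: (ultralimit_tail tailU (n := 0)) => r _; have := (hx r).1.2 i.
exists l => // x' bx'.
apply: (@le_trans _ _ (inf A)); last first.
  by apply: ge_inf; [case: infA | exists x'].
pose e r := \sum_i `|l 0 i - x r 0 i|.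
have ecvg : e @ U --> (\sum_(i < d) 0 : R).
  apply: cvg_big => [|i _]; first exact: add_continuous.
  rewrite -(normr0 R) -(subrr (l 0 i)); apply: cvg_norm.
  by apply: cvgB; [exact: cvg_cst | exact: xl].
have harm : (fun n => n.+1%:R^-1 : R) @ U --> (0 : R).
  by move=> B /(@cvg_harmonic R) /tailU.
have bnd : (fun r => inf A + r.+1%:R^-1 + C * e r) @ U -->
    inf A + 0 + C * \sum_(i < d) 0.
  apply: cvgD; last by apply: cvgM => //; exact: cvg_cst.
  by apply: cvgD => //; exact: cvg_cst.
have := cvgr_to_ge bnd (b := h l); rewrite big1// mulr0 !addr0; apply.
apply: (ultralimit_tail tailU (n := 0)) => r _.
apply: le_trans (lerD (hx r).2 (lexx _)); rewrite -lerBlDl.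
apply: le_trans (ler_norm _) _; apply: hC; first exact: sumr_ge0.
by move=> i; rewrite /e (bigD1 i)//= lerDl sumr_ge0.
Qed.

End MaxSums.

(** * The radial constraints *)

Section Radial.
Variable R : realType.

Lemma exists_small_nonroot (p : {poly R}) (delta : R) : p != 0 -> 0 < delta ->
  exists t, [/\ 0 < t, t <= delta & p.[t] != 0].
Proof.
move=> p0 delta0; apply: contrapT => h.
pose s := [seq delta / n.+1%:R | n <- iota 0 (size p)].
suff /(max_poly_roots p0) : all (root p) s.
  rewrite size_map size_iota ltnn map_inj_uniq ?iota_uniq.
    by move=> /(_ isT).
  move=> a b /(mulfI (lt0r_neq0 delta0)) /invr_inj /eqP.
  by rewrite eqr_nat => /eqP [].
apply/allP => _ /mapP[n _ ->]; apply: contrapT => /negP nr; apply: h.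
exists (delta / n.+1%:R); split=> //; first by rewrite divr_gt0.
by rewrite ler_pdivrMr// ler_peMr ?ler1n// ltW.
Qed.

(** Finitely many hyperplanes through the origin do not cover a neighbourhood
    of z in z + (the orthant): along the curve t |-> z + (t, t^2, ...) each of
    them is met at the roots of a nonzero polynomial. *)
Lemma exists_generic_shift d (D : seq 'rV[R]_d) (z : 'rV[R]_d) (delta : R) :
  0 < delta -> (forall v, v \in D -> v != 0) ->
  exists w : 'rV[R]_d, (forall i, 0 <= w 0 i <= delta) /\
    forall v, v \in D -> dot v (z + w) != 0.
Proof.
move=> delta0 D0.
pose p (v : 'rV[R]_d) : {poly R} := (dot v z)%:P + \sum_i v 0 i *: 'X^(i.+1).
pose w (t : R) : 'rV[R]_d := \row_i t ^+ i.+1.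
have pE v t : (p v).[t] = dot v (z + w t).
  rewrite dotC dotDl dotC [dot (w t) v]dotC /p !hornerE horner_sum.
  congr (_ + _).
  by apply: eq_bigr => i _; rewrite !hornerE mxE.
have p0 v : v != 0 -> p v != 0.
  apply: contraNneq => pv0; apply/eqP/rowP => i; rewrite mxE.
  have : (p v)`_i.+1 = 0 by rewrite pv0 coef0.
  rewrite coefD coefC /= add0r coef_sum (bigD1 i)//= coefZ coefXn eqxx mulr1.
  rewrite big1 ?addr0// => j ji; rewrite coefZ coefXn eqSS eq_sym.
  by rewrite (_ : (j == i :> nat) = false) ?mulr0//; apply/negbTE.
have [||t [t0 tm pt]] :=
    @exists_small_nonroot (\prod_(v <- D) p v) (Num.min delta 1).
- by rewrite prodf_seq_neq0; apply/allP => v vD /=; apply/p0/D0.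
- by rewrite lt_min delta0 ltr01.
move: tm; rewrite le_min => /andP[td t1].
exists (w t); split=> [i|v vD].
  rewrite mxE exprn_ge0 ?(ltW t0)//=; apply: le_trans td.
  by rewrite exprS ler_piMr ?exprn_ile1// ltW.
rewrite -pE; apply: contraNneq pt => pv0.
by rewrite horner_prod prodf_seq_eq0; apply/hasP; exists v => //; rewrite /= pv0.
Qed.

Section SlackRep.
Variables (d m : nat) (S : slack_rep R d m) (y : 'rV[R]_m).
Implicit Type i : multi_index S.

Definition active i z : Prop := forall k (j : 'I_(sr_pieces k).+1),
  dot (sr_slope j) z <= dot (sr_slope (i k)) z.

(** The slope of the radial function where i is active. *)
Definition active_slope i : 'rV[R]_d := \sum_k sr_coef y k *: sr_slope (i k).

Lemma diff_setP i v :
  reflect (exists k (j : 'I_(sr_pieces k).+1),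
             [/\ j != i k, v = sr_slope (i k) - sr_slope j & v != 0])
          (v \in diff_set i).
Proof.
apply: (iffP idP); rewrite !inE /=.
  move=> /andP[/allpairsPdep[k [j [_]]]]; rewrite mem_filter.
  move=> /andP[ji _] -> v0.
  by exists k, j.
move=> [k [j [ji -> ->]]]; rewrite andbT; apply/allpairsPdep.
by exists k, j; rewrite (mem_filter _ j) ji !mem_enum.
Qed.

Lemma sr_val_active i z :
  active i z -> sr_val S y z = dot (active_slope i) z.
Proof.
move=> h; rewrite dot_suml; apply: eq_bigr => k _.
by rewrite dotZl (fmax_eq (i := i k)).
Qed.

Lemma exists_active_index z : exists i, active i z.
Proof.
have ex k : exists j0 : 'I_(@sr_pieces R d m S k).+1,
    forall j : 'I_(@sr_pieces R d m S k).+1,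
      dot (sr_slope j) z <= dot (sr_slope j0) z.
  exact: (fmax_attained (fun j => dot (sr_slope j) z)).
have [i hi] := fin_all_exists ex.
by exists [ffun k => i k] => k j; rewrite ffunE.
Qed.

Lemma diff_set_ge0 i z :
  (forall v, v \in diff_set i -> 0 <= dot v z) <->
  active i z.
Proof.
split=> [h k j|h v /diff_setP[k [j [_ -> _]]]]; last by rewrite dotBl subr_ge0.
have [->//|ji] := eqVneq j (i k).
have [/eqP|v0] := eqVneq (sr_slope (i k) - sr_slope j) 0.
  by rewrite subr_eq0 => /eqP->.
by rewrite -subr_ge0 -dotBl; apply: h; apply/diff_setP; exists k, j.
Qed.

(** At a point of the orthant on none of the hyperplanes where two pieces
    agree, the multi-index of the active pieces has no nonpositive average:
    all the differences in its set are positive there. *)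
Lemma sr_val_ge0_generic (eta : multi_index S -> 'rV[R]_d -> R) z :
  radial_system y eta -> lev 0 z ->
  (forall k (i j : 'I_(@sr_pieces R d m S k).+1),
     sr_slope i - sr_slope j != 0 -> dot (sr_slope i - sr_slope j) z != 0) ->
  0 <= sr_val S y z.
Proof.
move=> rad z0 gen; have [i hi] := exists_active_index z.
rewrite (sr_val_active hi).
have pos v : v \in diff_set i -> 0 < dot v z.
  move=> vi; rewrite lt_def ((diff_set_ge0 i z).2 hi)// andbT.
  by move: vi => /diff_setP[k [j [_ -> v0]]]; exact: gen.
have sumE (e : 'rV[R]_d -> R) :
    dot (\sum_(v <- diff_set i) e v *: v) z =
    \sum_(v <- diff_set i) e v * dot v z.
  by rewrite dot_suml; apply: eq_bigr => v _; rewrite dotZl.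
have [|eta0 le_active] := rad i.
  move=> [e [e0 e1 /dot_levl /(_ z0)]]; rewrite sumE dot0l => le0.
  have ez0 v : v \in diff_set i -> 0 <= e v * dot v z.
    by move=> vi; rewrite mulr_ge0 ?e0// ltW// pos.
  have /allP ez :
      all (fun v => (v \in diff_set i) ==> (e v * dot v z == 0)) (diff_set i).
    by rewrite -psumr_eq0// -big_seq eq_le le0 big_seq sumr_ge0.
  have /eqP := oner_neq0 R; apply; rewrite -e1 big_seq big1// => v vi.
  by have := ez v vi; rewrite vi mulf_eq0 (gt_eqF (pos v vi)) orbF => /eqP.
apply: le_trans (dot_levl le_active z0).
rewrite sumE big_seq sumr_ge0// => v vi.
by rewrite mulr_ge0 ?eta0// ltW// pos.
Qed.

(** Generic points exist arbitrarily close to z, and sr_val is continuous. *)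
Lemma sr_val_ge0_of_radial (eta : multi_index S -> 'rV[R]_d -> R) z :
  radial_system y eta -> lev 0 z ->
  0 <= sr_val S y z.
Proof.
move=> rad z0; rewrite leNgt; apply/negP => neg.
have [C C0 hC] := sr_val_lipschitz S y.
pose pair (k : 'I_(sr_size S)) := ('I_(sr_pieces k).+1 * 'I_(sr_pieces k).+1)%type.
pose T := {k : 'I_(sr_size S) & pair k}.
pose D := [seq sr_slope (tagged p).1 - sr_slope (tagged p).2 | p : T].
(* a shift by delta changes sr_val by less than its absolute value at z *)
pose delta := - sr_val S y z / (C + 1).
have delta0 : 0 < delta by rewrite divr_gt0 ?oppr_gt0// ltr_wpDl.
have [v|w [w0 gen]] :=
    @exists_generic_shift _ [seq v <- D | v != 0] z delta delta0.
  by rewrite mem_filter => /andP[].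
have zw0 : lev 0 (z + w).
  move=> i; have := z0 i; have /andP[] := w0 i; rewrite !mxE => w1 _ z1.
  exact: addr_ge0.
have : 0 <= sr_val S y (z + w).
  apply: (sr_val_ge0_generic rad zw0) => k i j v0; apply: gen.
  rewrite mem_filter v0/=; apply/mapP.
  by exists (Tagged pair ((i, j) : pair k)); rewrite ?mem_enum.
have : `|sr_val S y (z + w) - sr_val S y z| <= C * delta.
  apply: hC => [|i]; first exact: ltW.
  by rewrite mxE addrAC subrr add0r; have /andP[? ?] := w0 i; rewrite ger0_norm.
move=> /(le_trans (ler_norm _)); rewrite lerBlDr => h1 h2.
have := le_trans h2 h1; rewrite leNgt => /negP; apply.
rewrite -ltrBrDr sub0r /delta mulrCA -ltr_pdivlMl ?oppr_gt0//.
rewrite mulVf ?oppr_eq0 ?lt_eqF//.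
by rewrite ltr_pdivrMr ?mul1r ?ltrDl// ltr_wpDl.
Qed.

(** On the cone where i is active, nonnegativity of the linear form given by
    active_slope is the hypothesis of Farkas' lemma for diff_set i. *)
Lemma radial_system_exists :
  (forall z, lev 0 z -> 0 <= sr_val S y z) ->
  exists eta : multi_index S -> 'rV[R]_d -> R, radial_system y eta.
Proof.
move=> h.
have /choice[eta heta] i : exists e : 'rV[R]_d -> R,
    (forall v, v \in diff_set i -> 0 <= e v) /\
    lev (\sum_(v <- diff_set i) e v *: v) (active_slope i).
  apply/(cone_leP _ (fset_uniq _))/farkas => z z0 /diff_set_ge0 hz.
  by rewrite -(sr_val_active hz); exact: h.
by exists eta => i _.
Qed.

End SlackRep.

Lemma cpwa_radial_scale d (r : cpwa R d) a z :
  0 <= a -> cpwa_radial r (a *: z) = a * cpwa_radial r z.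
Proof.
move=> a0; rewrite mulr_sumr; apply: eq_bigr => k _; rewrite mulrCA.
congr (_ * _); have [i hi] :=
  fmax_attained (fun i : 'I_(cp_pieces k).+1 => dot (cp_slope i) z).
rewrite (fmax_eq hi) (fmax_eq (i := i)) ?dotZr// => j.
by rewrite !dotZr ler_wpM2l.
Qed.

Lemma radial_ge0_bounded d (h ht : 'rV[R]_d -> R) : is_radial h ht ->
  (forall z, orthant z -> 0 <= ht z) ->
  exists M, forall x, orthant x -> M <= h x.
Proof.
move=> [r [hr htr]] ht0; have [C hC] := cpwa_radial_dist r.
exists (- C) => x x0; have := hC x.
rewrite -hr// -htr// ler_norml => /andP[+ _].
by rewrite lerBrDr => /(le_trans _); apply; rewrite lerDl ht0.
Qed.

(** Along a ray the radial function is linear and stays within bounded distance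
    of h. *)
Lemma bounded_radial_ge0 d (h ht : 'rV[R]_d -> R) M : is_radial h ht ->
  (forall x, orthant x -> M <= h x) -> forall z, orthant z -> 0 <= ht z.
Proof.
move=> [r [hr htr]] hM z z0; have [C hC] := cpwa_radial_dist r.
rewrite htr// leNgt; apply/negP => neg.
(* far enough along the ray of z for h to fall below M *)
pose a := (C - M + 1) / - cpwa_radial r z.
have CM : 0 <= C - M.
  have o0 : orthant (0 : 'rV[R]_d) by move=> i; rewrite mxE.
  have := hM _ o0; rewrite hr// => h1; have := hC 0.
  rewrite -(scale0r 0) cpwa_radial_scale// mul0r subr0 scale0r.
  by move=> /(le_trans (ler_norm _)) h2; rewrite subr_ge0; exact: le_trans h2.
have a0 : 0 <= a by rewrite divr_ge0 ?(addr_ge0 CM ler01)// oppr_ge0 ltW.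
have az : orthant (a *: z).
  by move=> i; have := z0 i; rewrite !mxE; exact: mulr_ge0.
have := hM _ az; rewrite hr//; have := hC (a *: z).
rewrite cpwa_radial_scale// (_ : a * _ = - (C - M + 1)); last first.
  by rewrite /a invrN mulrN mulNr divfK ?lt_eqF.
by move=> /(le_trans (ler_norm _)); lra.
Qed.

End Radial.

(** * Prices and arbitrage *)

Section Prices.
Variables (R : realType) (m : nat) (ask bid : 'rV[R]_m).
Hypothesis bid_ask : lev bid ask.
Implicit Types y yp ym : 'rV[R]_m.

Definition pos_part y : 'rV[R]_m := \row_j Num.max (y 0 j) 0.

Lemma pos_part_ge0 y : lev 0 (pos_part y).
Proof. by move=> j; rewrite !mxE le_max lexx orbT. Qed.

Lemma pos_partB y : pos_part y - pos_part (- y) = y.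
Proof.
apply/rowP => j; rewrite !mxE.
by case: (leP 0 (y 0 j)) => h; case: (leP 0 (- y 0 j)) => h'; lra.
Qed.

Lemma priceE y : price ask bid y = dot (pos_part y) ask - dot (pos_part (- y)) bid.
Proof. by rewrite -sumrB; apply: eq_bigr => j _; rewrite !mxE. Qed.

(** Buying and selling the same amount costs the bid-ask spread, so the split of
    a position into its positive and negative parts is the cheapest one. *)
Lemma price_le yp ym : lev 0 yp -> lev 0 ym ->
  price ask bid (yp - ym) <= dot yp ask - dot ym bid.
Proof.
move=> yp0 ym0; rewrite /price -sumrB; apply: ler_sum => j _.
have := bid_ask j; have := yp0 j; have := ym0 j; rewrite !mxE.
set p := yp 0 j; set n := ym 0 j; set a := ask 0 j; set b := bid 0 j => n0 p0 ba.
set M := Num.max (p - n) 0.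
have -> : Num.max (- (p - n)) 0 = M - (p - n).
  by rewrite /M; case: (leP 0 (p - n)) => h; case: (leP 0 (- (p - n))) => h'; lra.
have Mp : M <= p by rewrite ge_max p0 gerBl n0.
have : 0 <= (p - M) * (a - b) by rewrite mulr_ge0// subr_ge0.
by lra.
Qed.

Lemma price_add y y' : price ask bid (y + y') <= price ask bid y + price ask bid y'.
Proof.
rewrite -{1}(pos_partB y) -{1}(pos_partB y') addrACA -opprD.
apply: le_trans (price_le _ _) _.
- move=> j; have := pos_part_ge0 y j; have := pos_part_ge0 y' j.
  by rewrite !mxE; lra.
- move=> j; have := pos_part_ge0 (- y) j; have := pos_part_ge0 (- y') j.
  by rewrite !mxE; lra.
by rewrite !priceE !dotDl; lra.
Qed.

Lemma price_scale a y : 0 <= a -> price ask bid (a *: y) <= a * price ask bid y.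
Proof.
move=> a0; rewrite -{1}(pos_partB y) scalerBr.
apply: le_trans (price_le _ _) _.
- by move=> j; have := pos_part_ge0 y j; rewrite !mxE; exact: mulr_ge0.
- by move=> j; have := pos_part_ge0 (- y) j; rewrite !mxE; exact: mulr_ge0.
by rewrite priceE !dotZl mulrBr.
Qed.

Variables (d : nat) (g : 'rV[R]_d -> 'rV[R]_m).

Lemma orthant0 : orthant (0 : 'rV[R]_d).
Proof. by move=> i. Qed.

Lemma free_hedge_trivial c y : no_arbitrage ask bid g ->
  (forall x, orthant x -> 0 <= c + dot y (g x)) -> c + price ask bid y <= 0 ->
  forall x, orthant x -> c + dot y (g x) = 0.
Proof.
move=> NA hedge cheap x x0.
have eq0 : dot y (g x) - price ask bid y = 0.
  by apply: NA x0 => z z0; have := hedge _ z0; lra.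
by have := hedge _ x0; lra.
Qed.

Lemma hedge_price_ge0 c y : no_arbitrage ask bid g ->
  (forall x, orthant x -> 0 <= c + dot y (g x)) -> 0 <= c + price ask bid y.
Proof.
move=> NA hedge; rewrite leNgt; apply/negP => neg.
have [] := (NA y _ 0 orthant0, hedge _ orthant0).
  by move=> z z0; have := hedge _ z0; lra.
by lra.
Qed.

End Prices.

(** * Finiteness of the cutting-plane method *)

Section Finiteness.
Variable R : realType.

(** Points at which G has maximal rank: their values span the values of G, so a
    payoff <w, G> is recovered from its values there. *)
Lemma finite_determination (T : Type) (Om : T -> Prop) n (G : T -> 'rV[R]_n) :
  exists k (p : 'I_k -> T) (M : 'M[R]_(n, k)),
    (forall l, Om (p l)) /\ forall x, Om x -> forall w,
      dot w (G x) = dot (G x *m M) (\row_l dot w (G (p l))).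
Proof.
pose Q r := exists k (p : 'I_k -> T),
  (forall l, Om (p l)) /\ (r <= \rank (\matrix_l G (p l)))%N.
have exQ : exists r, `[< Q r >].
  exists 0%N; apply/asboolP.
  by exists 0%N, (fun l : 'I_0 => match notF (ltn_ord l) with end); split=> // -[].
have boundQ r : `[< Q r >] -> (r <= n)%N.
  by move=> /asboolP[k [p [_ /leq_trans]]]; apply; exact: rank_leq_col.
case: (ex_maxnP exQ boundQ) => r /asboolP[k [p [Omp rp]]] maxr.
pose B := \matrix_l G (p l).
have GB x : Om x -> (G x <= B)%MS.
  move=> Omx; apply: contrapT => /negP nGB.
  pose p' (l : 'I_k.+1) := if unlift ord0 l is Some l' then p l' else x.
  pose B' := \matrix_l G (p' l).
  have BB' : (B < B')%MS.
    have sBB' : (B <= B')%MS.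
      apply/row_subP => l; rewrite rowK.
      by rewrite (_ : G (p l) = row (lift ord0 l) B') ?row_sub// rowK /p' liftK.
    rewrite /ltmx sBB'/=; apply: contra nGB => sB'B.
    apply: submx_trans sB'B; rewrite (_ : G x = row ord0 B') ?row_sub//.
    by rewrite rowK /p' unlift_none.
  have : `[< Q r.+1 >].
    apply/asboolP; exists k.+1, p'.
    split; last exact: leq_ltn_trans rp (rank_ltmx BB').
    by move=> l; rewrite /p'; case: unliftP.
  by move=> /maxr; rewrite ltnn.
exists k, p, (pinvmx B); split=> // x Omx w.
rewrite -{1}(mulmxKpV (GB x Omx)) /dot.
under eq_bigr => j _ do rewrite mxE mulr_sumr.
rewrite exchange_big; apply: eq_bigr => l _.
rewrite [in RHS]mxE mulr_sumr; apply: eq_bigr => j _.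
by rewrite [B l j]mxE mulrCA.
Qed.

End Finiteness.

Section CuttingPlanes.
Variables (R : realType) (d m : nat) (ask bid : 'rV[R]_m).
Variable g : 'rV[R]_d -> 'rV[R]_m.
Hypotheses (bid_ask : lev bid ask) (NA : no_arbitrage ask bid g).

Definition with_cash (c : R) (y : 'rV[R]_m) : 'rV[R]_(1 + m) := row_mx c%:M y.

Lemma dot_with_cash c y c' y' :
  dot (with_cash c y) (with_cash c' y') = c * c' + dot y y'.
Proof.
rewrite /dot big_split_ord /= big_ord1 /with_cash !row_mxEl !mxE eqxx !mulr1n.
by congr (_ + _); apply: eq_bigr => i _; rewrite !row_mxEr.
Qed.

(** The values at the points p of the payoffs of portfolios whose price is at
    most 0. *)
Definition cheap_values k (p : 'I_k -> 'rV[R]_d) (v : 'rV[R]_k) : Prop :=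
  exists c yp ym, [/\ lev 0 yp, lev 0 ym, c + dot yp ask - dot ym bid <= 0
    & forall l, v 0 l = c + dot (yp - ym) (g (p l))].

(** This is what makes the limit of cheap payoffs a cheap payoff, although the
    portfolios that realize them may be unbounded. *)
Lemma polyhedral_cheap_values k (p : 'I_k -> 'rV[R]_d) :
  polyhedral (cheap_values p).
Proof.
pose V : lmodType R := (('rV[R]_k * R^o) * 'rV[R]_m)%type.
pose Q (q : V * 'rV[R]_m) :=
  (lev 0 q.1.2 /\ lev 0 q.2) /\
  ((q.1.1.2 : R) + dot q.1.2 ask - dot q.2 bid <= 0 /\
   forall l, q.1.1.1 0 l = (q.1.1.2 : R) + dot (q.1.2 - q.2) (g (p l))).
have pQ : polyhedral Q.
  have a11 : affine (fun q : V * 'rV[R]_m => q.1.1.1) by [].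
  have a12 : affine (fun q : V * 'rV[R]_m => q.1.1.2) by [].
  have a2 : affine (fun q : V * 'rV[R]_m => q.1.2) by [].
  have a3 : affine (fun q : V * 'rV[R]_m => q.2) by [].
  apply: polyhedral_and; first apply: polyhedral_and.
  - by apply: polyhedral_lev => //; exact: affine_cst.
  - by apply: polyhedral_lev => //; exact: affine_cst.
  apply: polyhedral_and.
    apply: polyhedral_le; last exact: affine_cst.
    apply: affine_add; first apply: affine_add => //.
      exact: (affine_comp (affine_dot ask)).
    apply: affine_opp; exact: (affine_comp (affine_dot bid)).
  apply: polyhedral_forall => l; apply: polyhedral_eq.
    exact: (affine_comp (affine_coord l)).
  apply: affine_add => //; apply: (affine_comp (affine_dot (g (p l)))).
  by apply: affine_add => //; exact: affine_opp.
have := polyhedral_exists (polyhedral_exists_rV (polyhedral_exists_rV pQ)).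
apply: polyhedral_ext => v; split.
  by move=> [c [yp [ym [[? ?] [? ?]]]]]; exists c, yp, ym.
by move=> [c [yp [ym [? ? ? ?]]]]; exists c, yp, ym.
Qed.

(** The point x r minimizes the r-th slack and is violated by at least eps, but
    it is a cut for all later portfolios.  The vectors (u r, 1) are normalized
    to (a r, t r), where u r lists the values that determine the r-th payoff.
    In the limit (aa, ta) the cuts give a nonnegative slack at the limit of the
    points x r, and the violation gives at most - ta * eps: thus ta = 0, and aa
    is the nonzero vector of values of a nonnegative payoff of price at
    most 0. *)
Lemma cutting_planes_stop0 (f : 'rV[R]_d -> R) (D : 'rV[R]_d -> Prop)
    (M eps : R) (c : nat -> R) (y : nat -> 'rV[R]_m) (x : nat -> 'rV[R]_d) :
  (forall z, D z -> orthant z) ->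
  (forall z, D z -> `|f z| <= M /\ forall j, `|g z 0 j| <= M) ->
  0 < eps ->
  (forall r, D (x r)) ->
  (forall q r, (r < q)%N -> f (x r) <= c q + dot (y q) (g (x r))) ->
  (forall r, c r + dot (y r) (g (x r)) - f (x r) <= - eps) ->
  (forall r z, orthant z ->
     dot (y r) (g (x r)) - f (x r) <= dot (y r) (g z) - f z) ->
  (forall r, c r + price ask bid (y r) <= 0) -> False.
Proof.
move=> Dorth bounded eps0 Dx cut violated xmin cheap.
have [k [p [Mx [p0 det]]]] :=
  finite_determination (@orthant R d) (fun z => with_cash 1 (g z)).
pose lam z := with_cash 1 (g z) *m Mx.
have valE c' y' z : orthant z ->
    c' + dot y' (g z) = dot (lam z) (\row_l (c' + dot y' (g (p l)))).
  move=> z0; have := det z z0 (with_cash c' y').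
  rewrite dot_with_cash mulr1 => ->.
  by congr dot; apply/rowP => l; rewrite !mxE dot_with_cash mulr1.
pose u r : 'rV[R]_k := \row_l (c r + dot (y r) (g (p l))).
pose n r := 1 + \sum_l `|u r 0 l|.
have n0 r : 0 < n r by rewrite ltr_wpDr// sumr_ge0.
pose t r := (n r)^-1.
have t0 r : 0 < t r by rewrite invr_gt0.
pose a r := t r *: u r.
have aE r z : orthant z -> dot (lam z) (a r) = t r * (c r + dot (y r) (g z)).
  by move=> z0; rewrite /a dotZr valE.
have norm1 r : \sum_l `|a r 0 l| + t r = 1.
  under eq_bigr => l _ do rewrite mxE normrM (gtr0_norm (t0 r)).
  by rewrite -mulr_sumr -[X in _ + X]mulr1 -mulrDr addrC mulVf ?gt_eqF.
have a1 r l : `|a r 0 l| <= 1.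
  rewrite -(norm1 r) (bigD1 l)//= -addrA lerDl addr_ge0 ?sumr_ge0//.
  exact/ltW/t0.
have t1 r : `|t r| <= 1.
  by rewrite (gtr0_norm (t0 r)) -(norm1 r) lerDr sumr_ge0.
have cheap_a r : cheap_values p (a r).
  exists (t r * c r), (t r *: pos_part (y r)), (t r *: pos_part (- y r)).
  split.
  - move=> j; have := pos_part_ge0 (y r) j.
    by rewrite !mxE; apply: mulr_ge0; exact: ltW.
  - move=> j; have := pos_part_ge0 (- y r) j.
    by rewrite !mxE; apply: mulr_ge0; exact: ltW.
  - rewrite !dotZl -mulrDr -mulrBr -addrA -priceE.
    by rewrite pmulr_rle0.
  - by move=> l; rewrite -scalerBr pos_partB dotZl -mulrDr mxE mxE.
have [lamB hlamB] : exists B, forall r l, `|lam (x r) 0 l| <= B.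
  exists (\sum_l \sum_j (1 + M) * `|Mx j l|) => r l.
  have M0 : 0 <= 1 + M.
    have [/(le_trans (normr_ge0 _)) ? _] := bounded _ (Dx r).
    by rewrite addr_ge0.
  have -> : lam (x r) 0 l = \sum_j with_cash 1 (g (x r)) 0 j * Mx j l.
    by rewrite mxE.
  rewrite [leRHS](bigD1 l)//=.
  apply: le_trans (ler_norm_sum _ _ _) _.
  rewrite -[leLHS]addr0 lerD//; last first.
    by apply: sumr_ge0 => i _; apply: sumr_ge0 => j _; rewrite mulr_ge0.
  apply: ler_sum => j _; rewrite normrM ler_wpM2r//.
  rewrite mxE; case: (fintype.split j) => i.
    rewrite mxE ord1 eqxx mulr1n normr1 lerDl.
    by have [/(le_trans (normr_ge0 _))] := bounded _ (Dx r).
  by have [_ /(_ i) /le_trans] := bounded _ (Dx r); apply; rewrite lerDr.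
have [U [ultraU tailU]] := tail_ultrafilter.
have [ta ta_lim] := ultralimit_exists ultraU tailU t1.
have [aa aa_lim] := ultralimit_rV ultraU tailU a1.
have [la la_lim] := ultralimit_rV ultraU tailU hlamB.
have [fa fa_lim] :=
  ultralimit_exists ultraU tailU (fun r => (bounded _ (Dx r)).1).
have atail := @ultralimit_tail U tailU.
have ta0 : 0 <= ta.
  by apply: (cvgr_to_ge ta_lim); apply: (atail 0%N) => r _; exact: ltW.
have cvg_cst_row l (v : 'rV[R]_l) :
    forall i, ((fun _ : nat => v 0 i) @ U --> v 0 i)%classic.
  by move=> i; exact: cvg_cst.
have lim_z z : ((fun r => dot (lam z) (a r) - t r * f z) @ U -->
    (dot (lam z) aa - ta * f z))%classic.
  apply: cvgB; first by apply: (ultralimit_dot ultraU) => //; exact: cvg_cst_row.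
  by apply: cvgM => //; exact: cvg_cst.
have lim_x : ((fun r => dot (lam (x r)) (a r) - t r * f (x r)) @ U -->
    (dot la aa - ta * fa))%classic.
  by apply: cvgB; [exact: (ultralimit_dot ultraU) | exact: cvgM].
(* first the later index q tends to infinity, then the index r of the cut *)
have lim_ge0 : 0 <= dot la aa - ta * fa.
  have lim_r : ((fun r => dot (lam (x r)) aa - ta * f (x r)) @ U -->
      (dot la aa - ta * fa))%classic.
    apply: cvgB; first by apply: (ultralimit_dot ultraU) => //; exact: cvg_cst_row.
    by apply: cvgM => //; exact: cvg_cst.
  apply: (cvgr_to_ge lim_r); apply: (atail 0%N) => r _.
  apply: (cvgr_to_ge (lim_z (x r))); apply: (atail r.+1) => q rq.
  rewrite /= aE; last exact/Dorth.
  by rewrite -mulrBr mulr_ge0 ?(ltW (t0 q))// subr_ge0 cut.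
have lim_le : dot la aa - ta * fa + ta * eps <= 0.
  have lim_e :
      ((fun r => dot (lam (x r)) (a r) - t r * f (x r) + t r * eps) @ U -->
      (dot la aa - ta * fa + ta * eps))%classic.
    by apply: cvgD => //; apply: cvgM => //; exact: cvg_cst.
  apply: (cvgr_to_le lim_e); apply: (atail 0%N) => r _.
  rewrite /= aE; last exact/Dorth.
  rewrite -mulrBr -mulrDr pmulr_rle0//.
  by have := violated r; lra.
have ta_eq0 : ta = 0.
  apply/le_anti; rewrite ta0 andbT -(pmulr_lle0 _ eps0).
  by apply: le_trans lim_le; rewrite lerDr.
have hedge z : orthant z -> 0 <= dot (lam z) aa.
  move=> z0; have lim_d : ((fun r => (dot (lam z) (a r) - t r * f z) -
       (dot (lam (x r)) (a r) - t r * f (x r))) @ U -->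
      (dot (lam z) aa - ta * f z - (dot la aa - ta * fa)))%classic.
    exact: cvgB.
  have : 0 <= dot (lam z) aa - ta * f z - (dot la aa - ta * fa).
    apply: (cvgr_to_ge lim_d); apply: (atail 0%N) => r _.
    rewrite /= !aE//; last exact/Dorth.
    rewrite -!mulrBr mulr_ge0 ?(ltW (t0 r))//.
    by have := xmin r z z0; lra.
  by move: lim_ge0; rewrite ta_eq0 !mul0r !subr0; lra.
have [c' [yp [ym [yp0 ym0 cheap' valp]]]] : cheap_values p aa.
  exact: (polyhedral_closed ultraU tailU (polyhedral_cheap_values p) aa_lim).
have aaE : aa = \row_l (c' + dot (yp - ym) (g (p l))).
  by apply/rowP => l; rewrite mxE.
have zero : forall z, orthant z -> c' + dot (yp - ym) (g z) = 0.
  apply: (free_hedge_trivial (ask := ask) (bid := bid)) => //.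
    by move=> z z0; rewrite valE// -aaE hedge.
  by have := price_le bid_ask yp0 ym0; lra.
have : 1 <= \sum_l `|aa 0 l| + ta.
  have lim_n : ((fun r => \sum_l `|a r 0 l| + t r) @ U -->
      (\sum_l `|aa 0 l| + ta))%classic.
    apply: cvgD => //; apply: cvg_big => [|l _]; first exact: add_continuous.
    exact: cvg_norm.
  by apply: (cvgr_to_ge lim_n); apply: (atail 0%N) => r _; rewrite norm1.
rewrite ta_eq0 addr0 big1 ?ler10// => l _.
by rewrite valp zero ?normr0//; exact: p0.
Qed.

(** Moving b out of both the cash and the target reduces a price bound b to the
    price bound 0, for which the cheap payoffs form a cone. *)
Lemma cutting_planes_stop (f : 'rV[R]_d -> R) (D : 'rV[R]_d -> Prop)
    (M eps b : R) (c : nat -> R) (y : nat -> 'rV[R]_m) (x : nat -> 'rV[R]_d) :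
  (forall z, D z -> orthant z) ->
  (forall z, D z -> `|f z| <= M /\ forall j, `|g z 0 j| <= M) ->
  0 < eps ->
  (forall r, D (x r)) ->
  (forall q r, (r < q)%N -> f (x r) <= c q + dot (y q) (g (x r))) ->
  (forall r, c r + dot (y r) (g (x r)) - f (x r) <= - eps) ->
  (forall r z, orthant z ->
     dot (y r) (g (x r)) - f (x r) <= dot (y r) (g z) - f z) ->
  (forall r, c r + price ask bid (y r) <= b) -> False.
Proof.
move=> Dorth bounded eps0 Dx cut violated xmin cheap.
apply: (@cutting_planes_stop0 (fun z => f z - b) D (M + `|b|) eps
          (fun r => c r - b) y x) => //.
- move=> z Dz; have [fM gM] := bounded z Dz; split=> [|j].
    by apply: le_trans (ler_normB _ _) _; rewrite lerD2r.
  by apply: le_trans (gM j) _; rewrite lerDl.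
- by move=> q r rq; have := cut q r rq; lra.
- by move=> r; have := violated r; lra.
- by move=> r z z0; have := xmin r z z0; lra.
- by move=> r; have := cheap r; lra.
Qed.

End CuttingPlanes.

(** * Linear programs and iterations of the algorithm *)

Section Algorithm.
Variables (R : realType) (d m : nat) (P : ecp_input R d m).
Local Notation ask := (in_ask P).
Local Notation bid := (in_bid P).
Local Notation g := (in_g P).
Local Notation f := (in_f P).
Local Notation S := (in_rep P).

Lemma affine_active_slope (i : multi_index S) :
  affine (fun y => active_slope y i).
Proof.
rewrite /active_slope; elim: (index_enum _) => [|k s IH].
  by under [X in affine X]eq_fun => y do rewrite big_nil; exact: affine_cst.
under [X in affine X]eq_fun => y do rewrite big_cons.
apply: affine_add => //; apply: (affine_comp (affine_scale _)).
by apply: affine_add; [exact: affine_dot | exact: affine_cst].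
Qed.

Lemma polyhedral_radial_feasible :
  polyhedral (fun y => exists eta, @radial_system R d m S y eta).
Proof.
apply: (@polyhedral_ext _ _ (fun y => forall i : multi_index S,
    ~ has_nonpos_average (diff_set i) -> cone_le (diff_set i) (active_slope y i))).
  move=> y; split=> [h|[eta h] i /h hi].
    have /choice[eta heta] (i : multi_index S) : exists e : 'rV[R]_d -> R,
        ~ has_nonpos_average (diff_set i) ->
        (forall v, v \in diff_set i -> 0 <= e v) /\
        lev (\sum_(v <- diff_set i) e v *: v) (active_slope y i).
      have [na|nna] := pselect (has_nonpos_average (diff_set i)).
        by exists (fun=> 0).
      by have [e he] := (cone_leP _ (fset_uniq _)).1 (h i nna); exists e.
    by exists eta.
  by apply/(cone_leP _ (fset_uniq _)); exists (eta i).
apply: polyhedral_forall => i; apply: polyhedral_imply.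
exact: polyhedral_preim (affine_active_slope i) (polyhedral_cone_le _).
Qed.

(** The auxiliary variables are eliminated first: they only say that
    yp - ym lies in the polyhedron of polyhedral_radial_feasible.  The attained
    values of the objective then form a polyhedron of the line, which the
    constraint on the objective bounds below. *)
Lemma lp_minimizer_exists X : (exists p : lp_point P, lp_feasible X p) ->
  exists p : lp_point P, lp_minimizer X p.
Proof.
move=> [p0 feas0].
pose V : lmodType R := ((R^o * R^o) * 'rV[R]_m)%type.
pose obj (q : V * 'rV[R]_m) : R := (q.1.1.2 : R) + dot q.1.2 ask - dot q.2 bid.
pose Q (q : V * 'rV[R]_m) :=
  [/\ exists eta, @radial_system R d m S (q.1.2 - q.2) eta,
      lev 0 q.1.2 /\ lev 0 q.2, (q.1.1.1 : R) = obj q,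
      phi_low P - in_tau P <= obj q
    & forall x, x \in X -> f x <= (q.1.1.2 : R) + dot (q.1.2 - q.2) (g x)].
have a11 : affine (fun q : V * 'rV[R]_m => q.1.1.1) by [].
have a12 : affine (fun q : V * 'rV[R]_m => q.1.1.2) by [].
have a2 : affine (fun q : V * 'rV[R]_m => q.1.2) by [].
have a3 : affine (fun q : V * 'rV[R]_m => q.2) by [].
have ay : affine (fun q : V * 'rV[R]_m => q.1.2 - q.2).
  by apply: affine_add => //; exact: affine_opp.
have aobj : affine (obj : _ -> R^o).
  apply: affine_add; first apply: affine_add => //.
    exact: (affine_comp (affine_dot ask)).
  apply: affine_opp; exact: (affine_comp (affine_dot bid)).
have pQ : polyhedral Q.
  pose Q' (q : V * 'rV[R]_m) :=
    (exists eta, @radial_system R d m S (q.1.2 - q.2) eta) /\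
    ((lev 0 q.1.2 /\ lev 0 q.2) /\ ((q.1.1.1 : R) = obj q /\
    (phi_low P - in_tau P <= obj q /\
     forall x, x \in enum_fset X ->
       f x <= (q.1.1.2 : R) + dot (q.1.2 - q.2) (g x)))).
  apply: (@polyhedral_ext _ _ Q').
    by move=> q; split=> [[? [? [? [? ?]]]]|[? ? ? ? ?]].
  apply: polyhedral_and.
    exact: polyhedral_preim ay polyhedral_radial_feasible.
  apply: polyhedral_and.
    by apply: polyhedral_and; apply: polyhedral_lev => //; exact: affine_cst.
  apply: polyhedral_and; first exact: polyhedral_eq.
  apply: polyhedral_and; first by apply: polyhedral_le => //; exact: affine_cst.
  apply: polyhedral_all => x; apply: polyhedral_le; first exact: affine_cst.
  by apply: affine_add => //; exact: (affine_comp (affine_dot (g x))).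
have := polyhedral_exists (polyhedral_exists_rV (polyhedral_exists_rV pQ)).
move=> /(polyhedral_minimum (b := phi_low P - in_tau P) (t0 := lp_obj p0))[].
- case: p0 feas0 => c y yp ym eta [/= rad ? yE ? ?].
  by exists c, yp, ym; split=> //; exists eta; rewrite -yE.
- by move=> t [c [yp [ym [_ _ /= -> ? _]]]].
move=> t [c [yp [ym [/= [eta rad] y0 tE low feas]]]] tmin.
exists (LpPoint c (yp - ym) yp ym eta); split=> // q [rad' y0' yE' low' feas'].
rewrite /lp_obj /= -/(obj (t, c, yp, ym)) -tE; apply: tmin.
exists (lp_c q), (lp_yp q), (lp_ym q); split=> //=.
by exists (lp_eta q); rewrite -yE'.
Qed.

Hypotheses (hf : is_cpwa f) (hg : forall j : 'I_m, is_cpwa (fun x => g x 0 j)).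
Hypothesis bid_ask : lev bid ask.
Hypothesis hphi : (phi ask bid g f < +oo)%E.
Hypothesis hrep : forall y : 'rV[R]_m, is_radial (slack g f y) (sr_val S y).
Hypothesis hX0 : forall x, x \in in_X0 P -> orthant x.
Hypotheses (heps : 0 < in_eps P) (hdelta : 0 < in_delta P <= 1).
Hypothesis htau : 0 < in_tau P.
Hypothesis xbar_pos : forall i, 0 < in_xbar P 0 i.
Hypothesis hxbar : forall y : 'rV[R]_m,
  let s := slack g f y in
  (-oo < ereal_inf [set (s x)%:E | x in @orthant R d])%E ->
  ereal_inf [set (s x)%:E | x in box (in_xbar P)] =
  ereal_inf [set (s x)%:E | x in @orthant R d].
Hypothesis hlow : super_replicates g (fun x => - f x) (in_c0 P) (in_y0 P).

Lemma xbar_ge0 : lev 0 (in_xbar P).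
Proof. by move=> i; rewrite mxE ltW. Qed.

Lemma slack_minimizer_exists y : exists x, slack_minimizer P y x.
Proof.
have [r [hr _]] := hrep y.
have [x bx xmin] := box_minimum (cpwa_lipschitz r) xbar_ge0.
exists x; split=> // x' bx'.
by rewrite !hr; [exact: xmin | exact: box_orthant bx' | exact: box_orthant bx].
Qed.

(** The radial constraints make the slack bounded below on the orthant, which is
    the condition under which the box contains a global minimizer. *)
Lemma slack_minimizer_global y eta x : @radial_system R d m S y eta ->
  slack_minimizer P y x ->
  forall z, orthant z -> slack g f y x <= slack g f y z.
Proof.
move=> rad [bx xmin] z z0.
have [M hM] := radial_ge0_bounded (hrep y) (fun z => sr_val_ge0_of_radial rad).
rewrite -lee_fin.
apply: (@le_trans _ _ (ereal_inf [set (slack g f y x)%:E | x in @orthant R d])).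
  rewrite -hxbar.
    by apply/ereal_infP => _ [x' bx' <-]; rewrite lee_fin xmin.
  apply: (@lt_le_trans _ _ M%:E); first exact: ltNyr.
  by apply/ereal_infP => _ [x' x'0 <-]; rewrite lee_fin hM.
by apply: ereal_inf_lbound; exists z.
Qed.

Lemma super_replicates_radial c y : super_replicates g f c y ->
  exists eta, @radial_system R d m S y eta.
Proof.
move=> sup; apply: radial_system_exists => z z0.
apply: (bounded_radial_ge0 (hrep y) (M := - c)) => // x x0.
by have := sup x x0; rewrite /slack; lra.
Qed.

Lemma lp_feasible_super (X : {fset 'rV[R]_d}) c y :
  (forall x, x \in X -> orthant x) -> super_replicates g f c y ->
  phi_low P - in_tau P <= c + price ask bid y ->
  exists2 p : lp_point P, lp_feasible X p & lp_obj p = c + price ask bid y.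
Proof.
move=> X0 sup low; have [eta rad] := super_replicates_radial sup.
have objE :
    c + dot (pos_part y) ask - dot (pos_part (- y)) bid = c + price ask bid y.
  by rewrite priceE addrA.
exists (LpPoint c y (pos_part y) (pos_part (- y)) eta) => //.
split=> //=; first by split; exact: pos_part_ge0.
- by rewrite pos_partB.
- by rewrite /lp_obj /= objE.
- by move=> x xX; rewrite pos_partB; apply/sup/X0.
Qed.

Lemma exists_super_replicates : exists c y, super_replicates g f c y.
Proof.
have [_ [[c y] sup _] _] := ereal_inf_lt hphi.
by exists c, y.
Qed.

(** Additional cash brings the price above phi_low - tau and keeps the portfolio
    super-replicating. *)
Lemma lp_feasible_exists (X : {fset 'rV[R]_d}) :
  (forall x, x \in X -> orthant x) -> exists p : lp_point P, lp_feasible X p.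
Proof.
move=> X0; have [c [y sup]] := exists_super_replicates.
pose low := phi_low P - in_tau P.
have sup' : super_replicates g f (Num.max c (low - price ask bid y)) y.
  by move=> x x0; apply: le_trans (sup x x0) _; rewrite lerD2r le_max lexx.
have [|p] := lp_feasible_super X0 sup'; last by exists p.
by rewrite -lerBlDr le_max lexx orbT.
Qed.

Lemma lp_feasible_sub (X Y : {fset 'rV[R]_d}) (p : lp_point P) :
  (forall x, x \in X -> x \in Y) -> lp_feasible Y p -> lp_feasible X p.
Proof. by move=> XY [? ? ? ? h]; split=> // x /XY; exact: h. Qed.

Lemma lp_price_le X (p : lp_point P) : lp_feasible X p ->
  lp_c p + price ask bid (lp_yp p - lp_ym p) <= lp_obj p.
Proof. by move=> [_ [? ?] _ _ _]; rewrite /lp_obj -addrA lerD2l price_le. Qed.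

(** Together with the portfolio (c0, y0) that dominates - f, the portfolio
    (c, y) hedges the zero payoff. *)
Lemma price_ge_phi_low c y : no_arbitrage ask bid g ->
  super_replicates g f c y -> phi_low P <= c + price ask bid y.
Proof.
move=> NA sup.
have : 0 <= c + in_c0 P + price ask bid (y + in_y0 P).
  apply: (hedge_price_ge0 NA) => x x0; rewrite dotDl.
  by have := sup x x0; have := hlow x0; lra.
by have := price_add bid_ask y (in_y0 P); rewrite /phi_low; lra.
Qed.

Lemma lp_minimizer_le (X : {fset 'rV[R]_d}) (p : lp_point P) c y :
  no_arbitrage ask bid g -> (forall x, x \in X -> orthant x) ->
  lp_minimizer X p -> super_replicates g f c y ->
  lp_obj p <= c + price ask bid y.
Proof.
move=> NA X0 [_ pmin] sup.
have [|q feas <-] := lp_feasible_super X0 sup; last exact: pmin.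
by have := price_ge_phi_low NA sup; have := htau; lra.
Qed.

Lemma ecp_run_rcons h (it : iterate P) : ecp_run (rcons h it) ->
  [/\ ecp_run h, ~ stopped h & iteration h it].
Proof.
move E : (rcons h it) => h' run; case: run E => [|h1 it1 run1 ns1 iter1].
  by move=> /(congr1 size); rewrite size_rcons.
by move=> /rcons_inj[-> ->].
Qed.

Lemma in_cuts_rcons h (it : iterate P) x :
  (x \in cuts (rcons h it)) = (x \in cuts h) || (x \in it_X it).
Proof. by rewrite /cuts -cats1 big_cat big_seq1 in_fsetU. Qed.

Lemma next_cuts_rcons h (it : iterate P) : next_cuts (rcons h it) = it_next it.
Proof. by rewrite /next_cuts map_rcons last_rcons. Qed.

Lemma iteration_next h (it : iterate P) x : iteration h it ->
  x \in it_next it -> box (in_xbar P) x.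
Proof.
move=> [_ _ _ [found [hbox _ ->]]]; rewrite !inE /= => /andP[xf _].
exact: hbox.
Qed.

Lemma next_cuts_orthant h : @ecp_run R d m P h ->
  forall x, x \in next_cuts h -> orthant x.
Proof.
case=> [|{}h it _ _ iter] x; first exact: hX0.
by rewrite next_cuts_rcons => /(iteration_next iter) /box_orthant.
Qed.

Lemma cuts_orthant h : @ecp_run R d m P h ->
  forall x, x \in cuts h -> orthant x.
Proof.
elim=> [|{}h it run IH _ iter] x; first by rewrite /cuts big_nil.
rewrite in_cuts_rcons => /orP[/IH//|].
by have [-> _ _ _] := iter; exact: next_cuts_orthant.
Qed.

Lemma iteration_minimizer h (it : iterate P) x : iteration h it ->
  slack_minimizer P (it_y it) x ->
  it_s it = it_c it + slack g f (it_y it) x /\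
  forall z, orthant z -> it_s it <= it_c it + slack g f (it_y it) z.
Proof.
move=> [_ [[rad _ yE _ _] _] [x0 [bx0 x0min] sE] _] xmin.
rewrite yE in rad; have glob := slack_minimizer_global rad xmin.
have xx0 : slack g f (it_y it) x0 = slack g f (it_y it) x.
  apply/le_anti/andP.
  by split; [exact: x0min xmin.1 | exact: glob (box_orthant bx0)].
by rewrite sE xx0; split=> // z z0; rewrite lerD2l glob.
Qed.

Lemma iteration_super_replicates h (it : iterate P) : iteration h it ->
  super_replicates g f (it_c it - it_s it) (it_y it).
Proof.
move=> iter x x0; have [x1 x1min] := slack_minimizer_exists (it_y it).
by have [_ /(_ x x0)] := iteration_minimizer iter x1min; rewrite /slack; lra.
Qed.

Lemma iteration_price_le h (it : iterate P) : iteration h it ->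
  it_c it + price ask bid (it_y it) <= it_phi it.
Proof. by move=> [_ [feas _] _ _]; exact: lp_price_le feas. Qed.

Lemma phi_le c y : super_replicates g f c y ->
  (phi ask bid g f <= (c + price ask bid y)%:E)%E.
Proof. by move=> sup; apply: ereal_inf_lbound; exists (c, y). Qed.

Lemma iteration_phi_le h (it : iterate P) : iteration h it ->
  (phi ask bid g f <= (it_phi it - it_s it)%:E)%E.
Proof.
move=> iter; apply: le_trans (phi_le (iteration_super_replicates iter)) _.
by rewrite lee_fin; have := iteration_price_le iter; lra.
Qed.

Lemma it_phi_le h (it : iterate P) c y : no_arbitrage ask bid g ->
  ecp_run (rcons h it) -> super_replicates g f c y ->
  it_phi it <= c + price ask bid y.
Proof.
move=> NA run; have [_ _ [_ pmin _ _]] := ecp_run_rcons run.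
by apply: lp_minimizer_le pmin => //; exact: cuts_orthant run.
Qed.

Lemma it_phi_le_phi h (it : iterate P) : no_arbitrage ask bid g ->
  ecp_run (rcons h it) -> ((it_phi it)%:E <= phi ask bid g f)%E.
Proof.
move=> NA run; apply/ereal_infP => _ [[c y] sup <-].
by rewrite lee_fin; exact: it_phi_le run sup.
Qed.

Lemma it_s_le0 h (it : iterate P) : no_arbitrage ask bid g ->
  ecp_run (rcons h it) -> it_s it <= 0.
Proof.
move=> NA run; have [_ _ iter] := ecp_run_rcons run.
have := it_phi_le NA run (iteration_super_replicates iter).
by have := iteration_price_le iter; lra.
Qed.

(** Successive linear programs only gain constraints. *)
Lemma it_phi_sorted h : @ecp_run R d m P h ->
  sorted (fun a b : R => a <= b) [seq it_phi it | it <- h].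
Proof.
elim=> [//|{}h it run IH _ [_ [feas _] _ _]].
case/lastP: h => [//|h it'] in run IH feas *.
have [_ _ [_ [_ pmin] _ _]] := ecp_run_rcons run.
have le_it : it_phi it' <= it_phi it.
  by apply: pmin; apply: lp_feasible_sub feas => x xX; rewrite in_cuts_rcons xX.
move: IH; rewrite !map_rcons; case: [seq it_phi it | it <- h] => [|a s] /=.
  by rewrite le_it.
by rewrite !rcons_path last_rcons le_it andbT.
Qed.

Lemma iteration_exists h : @ecp_run R d m P h -> exists it, iteration h it.
Proof.
move=> run.
have X0 x : x \in (cuts h `|` next_cuts h)%fset -> orthant x.
  by rewrite in_fsetU => /orP[]; [exact: cuts_orthant | exact: next_cuts_orthant].
have [p pmin] := lp_minimizer_exists (lp_feasible_exists X0).
have [x xmin] := slack_minimizer_exists (lp_yp p - lp_ym p).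
pose s := lp_c p + slack g f (lp_yp p - lp_ym p) x.
exists (Iterate (next_cuts h) p s
  [fset z in [fset x]%fset |
     (lp_c p + slack g f (lp_yp p - lp_ym p) z <= in_delta P * s)%R]%fset).
split=> //=.
- by rewrite /cuts -cats1 big_cat big_seq1.
- by exists x.
exists [fset x]%fset; split=> //.
  by move=> z; rewrite inE => /eqP->; case: xmin.
by exists x; rewrite ?inE.
Qed.

Lemma cpwa_box_bounded (h : 'rV[R]_d -> R) : is_cpwa h ->
  exists M : R, forall x, box (in_xbar P) x -> `|h x| <= M.
Proof.
move=> [r hr]; have [M hM] := lipschitz_box_bounded (cpwa_lipschitz r) xbar_ge0.
by exists M => x bx; rewrite hr; [exact: hM | exact: box_orthant bx].
Qed.

(** The minimizer found at each iteration passes the selection test because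
    delta <= 1 and it_s is negative, so it is a cut from the next iteration on. *)
Lemma ecp_run_finite : no_arbitrage ask bid g ->
  ~ exists t : nat -> iterate P, forall n, ecp_run (mkseq t n).
Proof.
move=> NA [t tinf].
have run r : ecp_run (rcons (mkseq t r) (t r)) by rewrite -mkseqS.
have iter r : iteration (mkseq t r) (t r) by have [] := ecp_run_rcons (run r).
have s_lt r : it_s (t r) < - in_eps P.
  have [_ ns _] := ecp_run_rcons (run r.+1).
  rewrite ltNge; apply/negP => hs; apply: ns.
  by exists (mkseq t r), (t r); rewrite mkseqS.
have /choice[x hx] r :
    exists x, slack_minimizer P (it_y (t r)) x /\ x \in it_next (t r).
  have [_ _ _ [found [_ [x xf xmin] nextE]]] := iter r.
  exists x; split=> //; rewrite nextE !inE /= xf /=.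
  have [<- _] := iteration_minimizer (iter r) xmin.
  by have [d0 d1] := andP hdelta; have := s_lt r; have := heps; nra.
have in_later a x0 q : x0 \in it_X (t a) -> (a < q)%N -> x0 \in cuts (mkseq t q).
  move=> x0a; elim: q => // q IH; rewrite ltnS leq_eqVlt mkseqS in_cuts_rcons.
  by move=> /predU1P[<-|/IH ->//]; rewrite x0a orbT.
have [c1 [y1 sup1]] := exists_super_replicates.
have [Mf hMf] := cpwa_box_bounded hf.
have /choice[Mg hMg] j := cpwa_box_bounded (hg j).
apply: (@cutting_planes_stop R d m ask bid g bid_ask NA f (box (in_xbar P))
  (`|Mf| + \sum_j `|Mg j|) (in_eps P) (c1 + price ask bid y1)
  (fun r => it_c (t r)) (fun r => it_y (t r)) x) => //.
- by move=> z; exact: box_orthant.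
- move=> z bz; split=> [|j].
    apply: le_trans (hMf z bz) _; apply: le_trans (ler_norm _) _.
    by rewrite lerDl sumr_ge0.
  apply: le_trans (hMg j z bz) _; apply: le_trans (ler_norm _) _.
  by rewrite (bigD1 j)//= addrCA lerDl addr_ge0// sumr_ge0.
- by move=> r; have [[]] := hx r.
- move=> q r rq; have [_ [[_ _ _ _ feas] _] _ _] := iter q.
  apply: feas; rewrite -mkseqS; apply: (in_later r.+1) => //.
  have [-> _ _ _] := iter r.+1; rewrite mkseqS next_cuts_rcons.
  by have [] := hx r.
- move=> r; have [sE _] := iteration_minimizer (iter r) (hx r).1.
  by rewrite -addrA -/(slack g f _ _) -sE ltW.
- move=> r z z0; have [sE /(_ z z0)] := iteration_minimizer (iter r) (hx r).1.
  by rewrite sE lerD2l.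
- move=> r; apply: le_trans (iteration_price_le (iter r)) _.
  exact: it_phi_le (run r) sup1.
Qed.

(** The sum (c', y') of (c, y) and (c0, y0) hedges the zero payoff at a negative
    price; adding a times that sum to (c, y) lowers the price without bound. *)
Lemma arbitrage_unbounded c y : super_replicates g f c y ->
  c + price ask bid y < phi_low P ->
  ~ no_arbitrage ask bid g /\ phi ask bid g f = -oo%E.
Proof.
move=> sup lt_low; split=> [NA|].
  by have := price_ge_phi_low NA sup; rewrite leNgt lt_low.
pose y' := y + in_y0 P; pose c' := c + in_c0 P.
have gap0 : 0 < phi_low P - (c + price ask bid y) by rewrite subr_gt0.
have cheap : c' + price ask bid y' <= - (phi_low P - (c + price ask bid y)).
  by have := price_add bid_ask y (in_y0 P); rewrite /phi_low /c' /y'; lra.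
move: gap0 cheap; set gap := phi_low P - _ => gap0 cheap.
have hedge x : orthant x -> 0 <= c' + dot y' (g x).
  by move=> x0; have := sup x x0; have := hlow x0; rewrite /y' /c' dotDl; lra.
have below M : (phi ask bid g f <= M%:E)%E.
  pose a := `|c + price ask bid y - M| / gap.
  have a0 : 0 <= a by rewrite divr_ge0// ltW.
  have supa : super_replicates g f (c + a * c') (y + a *: y').
    move=> x x0; rewrite dotDl dotZl addrACA -mulrDr.
    by rewrite -[f x]addr0 lerD ?sup// mulr_ge0// hedge.
  apply: le_trans (phi_le supa) _; rewrite lee_fin.
  have := price_add bid_ask y (a *: y'); have := price_scale bid_ask y' a0.
  have : a * (c' + price ask bid y') <= - `|c + price ask bid y - M|.
    apply: le_trans (ler_wpM2l a0 cheap) _.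
    by rewrite mulrN /a divfK// gt_eqF.
  by have := ler_norm (c + price ask bid y - M); rewrite mulrDr; lra.
move: below; case: (phi _ _ _ _) => [r|h|//].
  by move=> /(_ (r - 1)); rewrite lee_fin lerBrDr gerDl ler10.
by have := h 0; rewrite leye_eq.
Qed.

End Algorithm.
Theorem theorem3p1 (R : realType) (d m : nat) (P : ecp_input R d m)
  (hf : is_cpwa (in_f P))
  (hg : forall j : 'I_m, is_cpwa (fun x => in_g P x 0 j))
  (hprices : lev (in_bid P) (in_ask P))
  (hphi : (phi (in_ask P) (in_bid P) (in_g P) (in_f P) < +oo)%E)
  (hphiN : (phi (in_ask P) (in_bid P) (in_g P) (fun x => (- in_f P x)%R) < +oo)%E)
  (hrep : forall y : 'rV[R]_m,
     is_radial (slack (in_g P) (in_f P) y) (sr_val (in_rep P) y))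
  (hX0 : forall x, x \in in_X0 P -> orthant x)
  (heps : 0 < in_eps P)
  (htau : 0 < in_tau P)
  (hdelta : 0 < in_delta P <= 1)
  (hxbar_pos : forall i, 0 < in_xbar P 0 i)
  (hxbar : forall y : 'rV[R]_m,
     let s := slack (in_g P) (in_f P) y in
     (-oo < ereal_inf [set (s x)%:E | x in @orthant R d])%E ->
     ereal_inf [set (s x)%:E | x in box (in_xbar P)] =
     ereal_inf [set (s x)%:E | x in @orthant R d])
  (hlow : super_replicates (in_g P) (fun x => - in_f P x) (in_c0 P) (in_y0 P)) :
  let NA := no_arbitrage (in_ask P) (in_bid P) (in_g P) in
  let phi_f := phi (in_ask P) (in_bid P) (in_g P) (in_f P) in
  (NA ->
     (forall h : seq (iterate P), ecp_run h ->
        sorted (fun a b : R => a <= b) [seq it_phi it | it <- h]) /\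
     (forall (h : seq (iterate P)) (it : iterate P), ecp_run (rcons h it) ->
        it_s it <= 0 /\
        ((it_phi it)%:E <= phi_f <= (it_phi it - it_s it)%:E)%E)) /\
  (* Every execution can be continued until the stopping criterion holds,
     no execution is infinite, and every terminating one returns a solution *)
  (NA ->
     [/\ forall h : seq (iterate P), ecp_run h -> ~ stopped h ->
           exists it, iteration h it,
         ~ exists t : nat -> iterate P, forall n, ecp_run (mkseq t n)
       & forall res, ecp_terminates P res ->
           exists UB LB c y X,
             [/\ res = ReturnSolution UB LB c y X,
                 super_replicates (in_g P) (in_f P) c y,
                 ((c + price (in_ask P) (in_bid P) y)%:E
                    <= phi_f + (in_eps P)%:E)%E,
                 (LB%:E <= phi_f <= UB%:E)%E
               & UB - LB <= in_eps P]]) /\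
  (ecp_terminates P ReportUnbounded -> ~ NA /\ phi_f = -oo%E).
Proof.
move=> NA phi_f.
have run_bounds (h : seq (iterate P)) (it : iterate P) :
    NA -> ecp_run (rcons h it) ->
    it_s it <= 0 /\ ((it_phi it)%:E <= phi_f <= (it_phi it - it_s it)%:E)%E.
  move=> na run; have [_ _ iter] := ecp_run_rcons run; split.
    exact: (it_s_le0 hprices hrep hX0 htau hxbar_pos hxbar hlow na run).
  apply/andP; split; first exact: (it_phi_le_phi hprices hrep hX0 htau hlow na run).
  exact: (iteration_phi_le hprices hrep hxbar_pos hxbar iter).
split; last split.
- by move=> na; split=> [h|h it]; [exact: it_phi_sorted | exact: run_bounds].
- move=> na; split.
  + by move=> h run _; exact: (iteration_exists hphi hrep hX0 hxbar_pos run).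
  + exact: (ecp_run_finite hf hg hprices hphi hrep hX0 heps hdelta htau
              hxbar_pos hxbar hlow na).
  move=> _ [h [it [run stop ->]]].
  have [_ _ iter] := ecp_run_rcons run.
  have [_ /andP[phi_ge phi_le_UB]] := run_bounds h it na run.
  have sup : super_replicates (in_g P) (in_f P) (it_c it - it_s it) (it_y it).
    exact: (iteration_super_replicates hrep hxbar_pos hxbar iter).
  have priceE := iteration_price_le hprices iter.
  rewrite /final_result ltNge.
  have -> : phi_low P <= it_phi it - it_s it.
    apply: (@le_trans _ _
      (it_c it - it_s it + price (in_ask P) (in_bid P) (it_y it))).
      exact: (price_ge_phi_low hprices hlow na sup).
    by rewrite addrAC lerB.
  do 5!eexists; split; [by []|exact: sup| |by rewrite phi_ge|by lra].
  apply: (@le_trans _ _ ((it_phi it)%:E + (in_eps P)%:E)%E); last exact: leeD.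
  by rewrite -EFinD lee_fin; lra.
- move=> [h [it [run stop]]]; rewrite /final_result; case: ifP => // ltUB _.
  have [_ _ iter] := ecp_run_rcons run.
  apply: (arbitrage_unbounded hprices hlow
    (c := it_c it - it_s it) (y := it_y it)).
    exact: (iteration_super_replicates hrep hxbar_pos hxbar iter).
  apply: le_lt_trans ltUB; have := iteration_price_le hprices iter; lra.
Qed.
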